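(* Let $p$ be a prime and $r\in\mathbb N$. Let $m_1,\ldots,m_r,n_1,\ldots,n_r\in\mathbb N_0$ with $m_j\equiv n_j\pmod{(p-1)p^{l_j-1}}$ for some $l_j\in\mathbb N$ $(1\le j\le r)$. Then for $\gamma_1,\ldots,\gamma_r\in\mathbb Z_p$ and $c\in\mathbb N_{>1}$ with $(c,p)=1$, $$L_{p,r}(-m_1,\ldots,-m_r;\omega^{m_1},\ldots,\omega^{m_r};\gamma_1,\ldots,\gamma_r;c)\equiv L_{p,r}(-n_1,\ldots,-n_r;\omega^{n_1},\ldots,\omega^{n_r};\gamma_1,\ldots,\gamma_r;c)\pmod{p^{\min\{l_j\mid1\le j\le r\}}}.$$ In other words, \begin{align*} &\sum_{\substack{\xi_1^c=1\\ \xi_1\neq1}}\cdots\sum_{\substack{\xi_r^c=1\\ \xi_r\neq1}}\mathfrak B((m_j);(\xi_j);(\gamma_j))\\ &\quad+\sum_{d=1}^r\Bigl(-\frac1p\Bigr)^d\sum_{1\le i_1<\cdots<i_d\le r}\ \sum_{\rho_{i_1}^p=1}\cdots\sum_{\rho_{i_d}^p=1}\ \sum_{\substack{\xi_1^c=1\\ \xi_1\neq1}}\cdots\sum_{\substack{\xi_r^c=1\\ \xi_r\neq1}}\mathfrak B\Bigl((m_j);\bigl((\textstyle\prod_{j\le i_l}\rho_{i_l})^{\gamma_j}\xi_j\bigr);(\gamma_j)\Bigr)\\ &\equiv\sum_{\substack{\xi_1^c=1\\ \xi_1\neq1}}\cdots\sum_{\substack{\xi_r^c=1\\ \xi_r\neq1}}\mathfrak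 B((n_j);(\xi_j);(\gamma_j))\\ &\quad+\sum_{d=1}^r\Bigl(-\frac1p\Bigr)^d\sum_{1\le i_1<\cdots<i_d\le r}\ \sum_{\rho_{i_1}^p=1}\cdots\sum_{\rho_{i_d}^p=1}\ \sum_{\substack{\xi_1^c=1\\ \xi_1\neq1}}\cdots\sum_{\substack{\xi_r^c=1\\ \xi_r\neq1}}\mathfrak B\Bigl((n_j);\bigl((\textstyle\prod_{j\le i_l}\rho_{i_l})^{\gamma_j}\xi_j\bigr);(\gamma_j)\Bigr) \end{align*} modulo $p^{\min\{l_j\mid1\le j\le r\}}$, where $\prod_{j\le i_l}\rho_{i_l}$ is the product over those $l\in\{1,\dots,d\}$ with $j\le i_l$ (empty product $=1$). (Congruences are between elements of $\mathbb Z_p$.)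
   Context: $\mathbb N=\{1,2,\dots\}$, $\mathbb N_0=\mathbb N\cup\{0\}$. Put $q=4$ if $p=2$ and $q=p$ if $p\ge3$. Let $W=\{\pm1\}$ if $p=2$ and $W=\{\xi\in\mathbb Z_p^\times:\xi^{p-1}=1\}$ if $p\ge3$. Write $x=\omega(x)\langle x\rangle$ for the decomposition $\mathbb Z_p^\times=W\times(1+q\mathbb Z_p)$, $\omega^k(x)=\omega(x)^k$, and $\langle x\rangle^{s}=\sum_{n\ge0}\binom sn(\langle x\rangle-1)^n$ for $s\in\mathbb C_p$, $|s|_p<qp^{-1/(p-1)}$. For $z\in\mathbf P^1(\mathbb C_p)$ with $|z-1|_p\ge1$ let $\mathfrak m_z$ be the $p$-adic measure on $\mathbb Z_p$ with $\mathfrak m_z(j+p^N\mathbb Z_p)=\frac{z^j}{1-z^{p^N}}$ ($0\le j\le p^N-1$), with $\int_{\mathbb Z_p}f\,d\mathfrak m_z=\lim_{N\to\infty}\sum_{a=0}^{p^N-1}f(a)\mathfrak m_z(a+p^N\mathbb Z_p)$ for continuous $f$; multiple integrals use product measures. For $c\in\mathbb N_{>1}$ with $(c,p)=1$ let $\widetilde{\mathfrak m}_c=\sum_{\xi\in\mathbb C_p,\ \xi^c=1,\ \xi\ne1}\mathfrak m_\xi$ (a $\mathbb Z_p$-valued measure). Let $(\mathbb Z_p^r)'_{\{\gamma_j\}}=\{(x_j)\in\mathbb Z_p^r: p\nmid\sum_{j=1}^{k}x_j\gamma_j\text{ for all }1\le k\le r\}$. For $k_j\in\mathbb Z$ and $s_j\in\mathbb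 C_p$ with $|s_j|_p<qp^{-1/(p-1)}$, $$L_{p,r}(s_1,\ldots,s_r;\omega^{k_1},\ldots,\omega^{k_r};\gamma_1,\ldots,\gamma_r;c)=\int_{(\mathbb Z_p^r)'_{\{\gamma_j\}}}\prod_{k=1}^r\Bigl\langle\sum_{j=1}^kx_j\gamma_j\Bigr\rangle^{-s_k}\omega^{k_k}\Bigl(\sum_{j=1}^kx_j\gamma_j\Bigr)\prod_{j=1}^rd\widetilde{\mathfrak m}_c(x_j).$$ For $\gamma_j\in\mathbb Z_p$ and roots of unity $\xi_j\in\mathbb C_p\setminus\{1\}$, the twisted multiple Bernoulli numbers $\mathfrak B((n_j);(\xi_j);(\gamma_j))=\mathfrak B(n_1,\ldots,n_r;(\xi_j);(\gamma_j))\in\mathbb C_p$ are defined by $$\prod_{j=1}^r\frac1{1-\xi_j\exp(\gamma_j\sum_{k=j}^rt_k)}=\sum_{n_1,\ldots,n_r\ge0}\mathfrak B(n_1,\ldots,n_r;(\xi_j);(\gamma_j))\frac{t_1^{n_1}}{n_1!}\cdots\frac{t_r^{n_r}}{n_r!}.$$ All roots of unity $\xi_j,\rho_{i_l}$ in the sums lie in $\mathbb C_p$. For $\rho^p=1$ and $\gamma\in\mathbb Z_p$, $\rho^\gamma$ means $\rho^a$ for any integer $a\equiv\gamma\pmod p$. *)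

(* Defs.v *)
From HB Require Import structures.
From mathcomp Require Import all_boot all_order all_algebra.
From mathcomp Require Import all_classical all_reals all_analysis.

Set Implicit Arguments.
Unset Strict Implicit.
Unset Printing Implicit Defensive.

Import Order.TTheory GRing.Theory Num.Theory.
Import numFieldNormedType.Exports.

Local Open Scope classical_set_scope.
Local Open Scope ring_scope.

Section PadicField.
Context {R : realType} {K : closedFieldType}.
Variables (p : nat) (absp : K -> R).

Definition cvgp (u : nat -> K) (l : K) : Prop :=
  (fun n => absp (u n - l)) @ \oo --> (0 : R).

Definition limp (u : nat -> K) : K := xget 0 [set l | cvgp u l].

Definition cauchyp (u : nat -> K) : Prop :=
  forall e : R, 0 < e ->
  exists N : nat, forall i j : nat,
    (N <= i)%N -> (N <= j)%N -> absp (u i - u j) < e.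

(* Q_p is the topological closure of the prime field of C_p. *)
Definition padicQ : set K :=
  [set x | forall e : R, 0 < e -> exists a : rat, absp (x - ratr a) < e].

Definition padicZ : set K := [set x | padicQ x /\ absp x <= 1].

Definition algebraic_over_Qp (x : K) : Prop :=
  exists P : {poly K}, [/\ P != 0, forall i, padicQ P`_i & root P x].

(* These properties characterize C_p, the completion of an algebraic closure
   of Q_p, up to isometric isomorphism; that K is algebraically closed is
   carried by its type. *)
Record is_Cp : Prop := IsCp {
  absp_ge0 : forall x, 0 <= absp x;
  absp_eq0 : forall x, absp x = 0 <-> x = 0;
  abspM : forall x y, absp (x * y) = absp x * absp y;
  abspD : forall x y, absp (x + y) <= Num.max (absp x) (absp y);
  absp_p : absp p%:R = p%:R^-1;
  absp_complete : forall u, cauchyp u -> exists l, cvgp u l;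
  absp_dense : forall (x : K) (e : R), 0 < e ->
    exists y, algebraic_over_Qp y /\ absp (x - y) < e
}.

(* For x in Z_p: p^k divides x in Z_p. *)
Definition pdvd (k : nat) (x : K) : Prop :=
  exists z, padicZ z /\ x = p%:R ^+ k * z.

Definition congrZp (k : nat) (x y : K) : Prop :=
  [/\ padicZ x, padicZ y & pdvd k (x - y)].

Definition unitZp : set K := [set x | [/\ padicZ x, x != 0 & padicZ x^-1]].

Definition qp : nat := if p == 2%N then 4 else p.

Definition Wp : set K :=
  if p == 2%N then [set w | w = 1 \/ w = -1]
  else [set w | unitZp w /\ w ^+ p.-1 = 1].

Definition omega (x : K) : K :=
  xget 1 [set w | Wp w /\ exists y, padicZ y /\ x = w * (1 + qp%:R * y)].

Definition angle (x : K) : K := x / omega x.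

Definition binomp (s : K) (n : nat) : K :=
  (\prod_(i < n) (s - i%:R)) / n`!%:R.

(* <x>^s; the series converges for x in Z_p^* and
   |s|_p < q * p^(-1/(p-1)), which includes every s in Z_p. *)
Definition angle_pow (x s : K) : K :=
  limp (fun N => \sum_(n < N) binomp s n * (angle x - 1) ^+ n).

(* A p-adic measure mu on Z_p is encoded by its values on balls:
   mu N j stands for mu(j + p^N Z_p), for 0 <= j < p^N. *)
Definition measZp := nat -> nat -> K.

(* m_z for a finite point z with |z - 1|_p >= 1. *)
Definition mz (z : K) : measZp := fun N j => z ^+ j / (1 - z ^+ (p ^ N)).

Definition nontriv_roots (c : nat) : set K := [set xi | xi ^+ c = 1 /\ xi <> 1].

Definition mtilde (c : nat) : measZp :=
  fun N j => \sum_(xi \in nontriv_roots c) mz xi N j.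

(* The integral over D of f against the r-fold product measure mu x ... x mu,
   for D clopen in Z_p^r and f continuous on D. *)
Definition integralZp (r : nat) (mu : measZp) (D : set ('I_r -> K))
    (f : ('I_r -> K) -> K) : K :=
  limp (fun N => \sum_(a : {ffun 'I_r -> 'I_(p ^ N)})
    let x := fun j => (a j : nat)%:R in
    f x * \1_D x * \prod_(j < r) mu N (a j)).

Definition lin (r : nat) (gamma x : 'I_r -> K) (k : 'I_r) : K :=
  \sum_(j < r | (j <= k)%N) x j * gamma j.

Definition Zpr' (r : nat) (gamma : 'I_r -> K) : set ('I_r -> K) :=
  [set x | (forall j, padicZ (x j)) /\ forall k, ~ pdvd 1 (lin gamma x k)].

Definition padicL (r : nat) (s : 'I_r -> K) (kk : 'I_r -> int)
    (gamma : 'I_r -> K) (c : nat) : K :=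
  integralZp (mtilde c) (Zpr' gamma)
    (fun x => \prod_(k < r)
       (angle_pow (lin gamma x k) (- s k) * omega (lin gamma x k) ^ kk k)).

(* rho^gamma, for rho^p = 1 and gamma in Z_p. *)
Definition root_pow (rho gamma : K) : K :=
  rho ^ xget (0 : int) [set a : int | pdvd 1 (gamma - a%:~R)].

End PadicField.

Section FormalPowerSeries.
Context {K : fieldType} {r : nat}.

(* K[[t_1, ..., t_r]]: f n is the coefficient of t_1^(n 1) ... t_r^(n r). *)
Definition pseries := {ffun 'I_r -> nat} -> K.

Definition ps_one : pseries := fun n => (n == [ffun=> 0%N])%:R.

Definition ps_mul (f g : pseries) : pseries := fun n =>
  \sum_(ab \in [set ab : {ffun 'I_r -> nat} * {ffun 'I_r -> nat} |
                 forall i, (ab.1 i + ab.2 i)%N = n i])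
    f ab.1 * g ab.2.

Definition ps_inv (f : pseries) : pseries :=
  xget (fun=> 0) [set g | ps_mul f g = ps_one].

Definition ps_var (k : 'I_r) : pseries :=
  fun n => (n == [ffun i => (i == k : nat)])%:R.

(* exp f = sum_N f^N / N!, for f without constant term: f^N then has no
   coefficient of total degree smaller than N. *)
Definition ps_exp (f : pseries) : pseries := fun n =>
  \sum_(N < (\sum_(i < r) n i).+1) iter N (ps_mul f) ps_one n / N`!%:R.

Definition twisted_gen (xi gamma : 'I_r -> K) : pseries :=
  \big[ps_mul/ps_one]_(j < r)
    ps_inv (fun n => ps_one n -
      xi j * ps_exp (fun n' => gamma j *
                       \sum_(k < r | (j <= k)%N) ps_var k n') n).

Definition twistedB (n : 'I_r -> nat) (xi gamma : 'I_r -> K) : K :=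
  (\prod_(i < r) (n i)`!)%:R * twisted_gen xi gamma [ffun i => n i].

End FormalPowerSeries.

Section BernoulliSide.
Context {R : realType} {K : closedFieldType}.
Variables (p : nat) (absp : K -> R).

Definition bernoulli_sum (r : nat) (n : 'I_r -> nat) (gamma : 'I_r -> K)
    (c : nat) : K :=
  \sum_(xi \in [set xi : {ffun 'I_r -> K} |
                         forall j, nontriv_roots c (xi j)]) twistedB n xi gamma
  + \sum_(1 <= d < r.+1) (- (p%:R^-1)) ^+ d *
      \sum_(i : {ffun 'I_d -> 'I_r} |
              [forall a : 'I_d, forall b : 'I_d, (a < b)%N ==> (i a < i b)%N])
        \sum_(rho \in [set rho : {ffun 'I_d -> K} | forall l, rho l ^+ p = 1])
          \sum_(xi \in [set xi : {ffun 'I_r -> K} |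
                         forall j, nontriv_roots c (xi j)])
            twistedB n
              (fun j => root_pow p absp (\prod_(l < d | (j <= i l)%N) rho l)
                          (gamma j) * xi j)
              gamma.

End BernoulliSide.

(* Main.v *)
Require Import Defs.
From HB Require Import structures.
From mathcomp Require Import all_boot all_order all_algebra.
From mathcomp Require Import all_classical all_reals all_analysis.
From mathcomp Require Import ring separable cyclotomic cyclic.

Set Implicit Arguments.
Unset Strict Implicit.
Unset Printing Implicit Defensive.

Import Order.TTheory GRing.Theory Num.Theory.
Local Open Scope classical_set_scope.
Local Open Scope ring_scope.

(** For a unit x of Z_p, <x>^m omega(x)^m = x^m, so the L-value at (-m_k) is the
    limit of the Riemann sums of prod_k (sum_(j <= k) x_j gamma_j)^(m_k) over the
    set where all these linear forms are units. There Euler's theorem makes the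
    integrands for m and n congruent, and the measure is Z_p-valued; hence the
    L-values are congruent.

    The Bernoulli expression is the same limit. The generating series of the
    Riemann sums for the measures m_(z_j) is a product of geometric sums, namely
    the generating series of the twisted Bernoulli numbers times
    prod_j (1 - z_j^P exp(P gamma_j T_j)) / (1 - z_j^P), P = p^N,
    T_j = sum_(k >= j) t_k, and the last product tends to 1 coefficientwise as
    P -> 0 in Z_p. The condition "p does not divide y_k for all k" is encoded by
    prod_k (1 - p^-1 sum_(rho^p = 1) rho^(y_k)); expanding it produces the sum over
    d, i_1 < ... < i_d and rho, and multiplying m_xi by rho^(gamma x) gives
    m_(rho^gamma xi). *)

(** * Formal power series *)

Lemma set_index_enum (J : finType) : [set` index_enum J] = setT.
Proof. by apply/seteqP; split=> x //= _; rewrite mem_index_enum. Qed.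

(** The sums over roots of unity are finitely supported sums over subsets of the field; a
    parametrization by a finite type turns them into ordinary sums, which can be exchanged and
    distributed. *)
Lemma fsum_reindex (K : nmodType) (J : finType) (T : choiceType) (A : set T)
    (g : J -> T) (F : T -> K) :
  set_bij setT A g -> \sum_(x \in A) F x = \sum_j F (g j).
Proof.
move=> gA; rewrite (@reindex_fsbig _ _ _ _ _ g setT A) // -(set_index_enum J).
by rewrite -fsbig_seq ?index_enum_uniq.
Qed.

(** * Exponent vectors of monomials in [r] variables *)

Section Monomials.
Variable r : nat.
Implicit Types n a b : {ffun 'I_r -> nat}.

Definition mon_add a b : {ffun 'I_r -> nat} := [ffun i => (a i + b i)%N].

Definition mon_deg n := (\sum_i n i)%N.

Definition mon0 : {ffun 'I_r -> nat} := [ffun=> 0%N].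

(** Embeds the finite box of exponents at most [D] in each variable. Coefficients of products are
    computed inside such a box, so that sums run over finite types. *)
Definition mon_of D (a : {ffun 'I_r -> 'I_D.+1}) : {ffun 'I_r -> nat} :=
  [ffun i => (a i : nat)].

Lemma mon_addC a b : mon_add a b = mon_add b a.
Proof. by apply/ffunP => i; rewrite !ffunE addnC. Qed.

Lemma mon_addA a b c : mon_add a (mon_add b c) = mon_add (mon_add a b) c.
Proof. by apply/ffunP => i; rewrite !ffunE addnA. Qed.

Lemma mon_add0 n : mon_add mon0 n = n.
Proof. by apply/ffunP => i; rewrite !ffunE. Qed.

Lemma mon_degD a b : mon_deg (mon_add a b) = (mon_deg a + mon_deg b)%N.
Proof.
by rewrite /mon_deg -big_split /=; apply: eq_bigr => i _; rewrite ffunE.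
Qed.

Lemma mon_deg_eq0 n : (mon_deg n == 0%N) = (n == mon0).
Proof.
rewrite sum_nat_eq0; apply/forallP/eqP => [n0|-> i]; last by rewrite ffunE.
by apply/ffunP => i; rewrite ffunE; apply/eqP/n0.
Qed.

Lemma leq_mon_deg n i : (n i <= mon_deg n)%N.
Proof. by rewrite /mon_deg (bigD1 i) //= leq_addr. Qed.

Lemma mon_bound n : exists D, forall i, (n i <= D)%N.
Proof. by exists (mon_deg n) => i; exact: leq_mon_deg. Qed.

Lemma mon_of_inj D : injective (@mon_of D).
Proof.
by move=> a b /ffunP ab; apply/ffunP => i; apply: val_inj; move: (ab i); rewrite !ffunE.
Qed.

Lemma mon_ofP D n :
  (forall i, n i <= D)%N -> exists a : {ffun 'I_r -> 'I_D.+1}, mon_of a = n.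
Proof.
move=> nD; exists ([ffun i => inord (n i)] : {ffun 'I_r -> 'I_D.+1}).
by apply/ffunP => i; rewrite !ffunE inordK // ltnS.
Qed.

Lemma eq_mon_prod (K : comPzRingType) n a : (n == a)%:R = \prod_i (n i == a i)%:R :> K.
Proof.
case: eqP => [->|na]; first by rewrite big1 // => i _; rewrite eqxx.
have [i ni] : exists i, n i != a i.
  apply/existsP; rewrite -negb_forall; apply/negP => /forallP e; apply: na.
  by apply/ffunP => i; apply/eqP/e.
by rewrite (bigD1 i) //= (negPf ni) mul0r.
Qed.

End Monomials.

(** * The ring of formal power series in [r] variables, with inverses and exponentials *)

Section PowerSeriesRing.
Variables (K : fieldType) (r : nat).

(* An alias: function types already carry the pointwise product. *)
Definition psr : Type := @Defs.pseries K r.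

HB.instance Definition _ := gen_eqMixin psr.
HB.instance Definition _ := gen_choiceMixin psr.

Implicit Types f g h : psr.
Implicit Types n : {ffun 'I_r -> nat}.

Definition psr_zero : psr := fun=> 0.
Definition psr_opp f : psr := fun n => - f n.
Definition psr_add f g : psr := fun n => f n + g n.

Lemma psr_addA : associative psr_add.
Proof. by move=> f g h; apply/funext => n; rewrite /psr_add addrA. Qed.
Lemma psr_addC : commutative psr_add.
Proof. by move=> f g; apply/funext => n; rewrite /psr_add addrC. Qed.
Lemma psr_add0 : left_id psr_zero psr_add.
Proof. by move=> f; apply/funext => n; rewrite /psr_add add0r. Qed.
Lemma psr_addN : left_inverse psr_zero psr_opp psr_add.
Proof. by move=> f; apply/funext => n; rewrite /psr_add addNr. Qed.

HB.instance Definition _ :=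
  GRing.isZmodule.Build psr psr_addA psr_addC psr_add0 psr_addN.

(** If [a + b = n] then [a] and [b] are bounded by [n], so any box containing [n] sees every
    contribution. Leaving [D] free lets one box serve nested products, and the 0/1 factor keeps the
    sum symmetric. *)
Lemma ps_mulE D f g n : (forall i, n i <= D)%N ->
  ps_mul f g n = \sum_(a : {ffun 'I_r -> 'I_D.+1}) \sum_(b : {ffun 'I_r -> 'I_D.+1})
    (mon_add (mon_of a) (mon_of b) == n)%:R * (f (mon_of a) * g (mon_of b)).
Proof.
move=> nD; rewrite pair_big /= /ps_mul.
pose T := ({ffun 'I_r -> 'I_D.+1} * {ffun 'I_r -> 'I_D.+1})%type.
pose up (ab : T) := (mon_of ab.1, mon_of ab.2).
pose P := [set ab : T | mon_add (mon_of ab.1) (mon_of ab.2) == n].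
rewrite (@reindex_fsbig _ _ _ _ _ up P); last first.
  split.
  - by move=> ab /eqP /ffunP e i; move: (e i); rewrite ffunE.
  - by move=> [a b] [a' b'] _ _ [/mon_of_inj -> /mon_of_inj ->].
  - move=> [a b] /= abn.
    have [a' a'E] : exists a' : {ffun 'I_r -> 'I_D.+1}, mon_of a' = a.
      by apply: mon_ofP => i; apply: leq_trans (nD i); rewrite -abn leq_addr.
    have [b' b'E] : exists b' : {ffun 'I_r -> 'I_D.+1}, mon_of b' = b.
      by apply: mon_ofP => i; apply: leq_trans (nD i); rewrite -abn leq_addl.
    exists (a', b'); rewrite /P /up /= ?a'E ?b'E //.
    by apply/eqP/ffunP => i; rewrite ffunE.
rewrite fsbig_mkcond -(set_index_enum T) -fsbig_seq ?index_enum_uniq //.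
apply: eq_bigr => -[a b] _; rewrite /patch /=; case: ifPn.
  by rewrite in_setE /P /= => ->; rewrite mul1r.
by rewrite notin_setE /P /= => /negP/negPf ->; rewrite mul0r.
Qed.

Lemma ps_mulC : commutative (@ps_mul K r).
Proof.
move=> f g; apply/funext => n; have [D nD] := mon_bound n; rewrite !(ps_mulE _ _ nD).
rewrite exchange_big; apply: eq_bigr => a _; apply: eq_bigr => b _.
by rewrite mon_addC [f _ * _]mulrC.
Qed.

(** The right side is symmetric in the three series up to exchanging sums; together with
    commutativity this gives associativity. *)
Lemma ps_mulA_E D f g h n : (forall i, n i <= D)%N ->
  ps_mul (ps_mul f g) h n =
  \sum_(a : {ffun 'I_r -> 'I_D.+1}) \sum_(b : {ffun 'I_r -> 'I_D.+1})
    \sum_(c : {ffun 'I_r -> 'I_D.+1})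
    (mon_add (mon_add (mon_of a) (mon_of b)) (mon_of c) == n)%:R *
      (f (mon_of a) * g (mon_of b) * h (mon_of c)).
Proof.
move=> nD; rewrite (ps_mulE _ _ nD).
have xD (x : {ffun 'I_r -> 'I_D.+1}) i : (mon_of x i <= D)%N.
  by rewrite ffunE -ltnS ltn_ord.
under eq_bigr => x _ do under eq_bigr => c _ do
  rewrite (ps_mulE _ _ (xD x)) mulr_suml mulr_sumr.
under eq_bigr => x _ do rewrite exchange_big /=.
rewrite exchange_big /=; apply: eq_bigr => a _.
under eq_bigr => x _ do under eq_bigr => c _ do
  rewrite mulr_suml mulr_sumr.
under eq_bigr => x _ do rewrite exchange_big /=.
rewrite exchange_big /=; apply: eq_bigr => b _.
rewrite exchange_big /=; apply: eq_bigr => c _.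
(* The intermediate exponent [x = a + b] lies in the box as soon as [a + b + c = n], and then it is
   the only [x] that contributes. *)
have [abc|abc] := eqVneq (mon_add (mon_add (mon_of a) (mon_of b)) (mon_of c)) n.
  have [x0 x0E] : exists x : {ffun 'I_r -> 'I_D.+1},
      mon_of x = mon_add (mon_of a) (mon_of b).
    by apply: mon_ofP => i; apply: leq_trans (nD i); rewrite -abc [leqRHS]ffunE leq_addr.
  rewrite (bigD1 x0) //= x0E abc !eqxx !mul1r big1 ?addr0 // => x xx0.
  rewrite -x0E (inj_eq (@mon_of_inj _ _)) [x0 == x]eq_sym (negPf xx0).
  by rewrite mul0r mul0r mulr0.
rewrite mul0r big1 // => x _.
have [<-|] := eqVneq _ (mon_of x); last by rewrite !(mul0r, mulr0).
by rewrite (negPf abc) mul0r.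
Qed.

Lemma ps_mulA : associative (@ps_mul K r).
Proof.
move=> f g h; apply/funext => n.
have [D nD] := mon_bound n; rewrite ps_mulC !(ps_mulA_E _ _ _ nD).
rewrite exchange_big /=.
under eq_bigr => b _ do rewrite exchange_big /=.
rewrite exchange_big /=.
apply: eq_bigr => a _; rewrite exchange_big /=.
apply: eq_bigr => b _; apply: eq_bigr => c _.
by rewrite mon_addC mon_addA; congr (_ * _); rewrite mulrC mulrA.
Qed.

Lemma ps_mul1 : left_id (@ps_one K r) (@ps_mul K r).
Proof.
move=> f; apply/funext => n.
have [D nD] := mon_bound n.
rewrite (ps_mulE _ _ nD).
have [z zE] : exists z : {ffun 'I_r -> 'I_D.+1}, mon_of z = mon0 r.
  by apply: mon_ofP => i; rewrite ffunE.
have [m mE] : exists m : {ffun 'I_r -> 'I_D.+1}, mon_of m = n.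
  exact: mon_ofP.
rewrite (bigD1 z) //= [X in _ + X]big1 ?addr0 => [|a az]; last first.
  apply: big1 => b _; rewrite /ps_one -/(mon0 r) -zE (inj_eq (@mon_of_inj _ _)).
  by rewrite (negPf az) mul0r mulr0.
rewrite zE (bigD1 m) //= mE mon_add0 eqxx /ps_one eqxx !mul1r big1 ?addr0 //.
move=> b bm; rewrite mon_add0 -[in _ == n]mE (inj_eq (@mon_of_inj _ _)) (negPf bm).
by rewrite mul0r.
Qed.

Lemma ps_mulDl : left_distributive (@ps_mul K r) psr_add.
Proof.
move=> f g h; apply/funext => n; rewrite /psr_add.
have [D nD] := mon_bound n; rewrite !(ps_mulE _ _ nD).
rewrite -big_split; apply: eq_bigr => a _; rewrite -big_split.
by apply: eq_bigr => b _ /=; rewrite -mulrDr -mulrDl.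
Qed.

Lemma ps_one_neq0 : (@ps_one K r : psr) != 0.
Proof.
apply/eqP => /(congr1 (fun f : psr => f (mon0 r))); rewrite /ps_one eqxx.
by apply/eqP; exact: oner_neq0.
Qed.

HB.instance Definition _ := GRing.Zmodule_isComNzRing.Build psr
  ps_mulA ps_mulC ps_mul1 ps_mulDl ps_one_neq0.

Lemma psr_mulE D f g n : (forall i, n i <= D)%N ->
  (f * g) n = \sum_(a : {ffun 'I_r -> 'I_D.+1}) \sum_(b : {ffun 'I_r -> 'I_D.+1})
    (mon_add (mon_of a) (mon_of b) == n)%:R * (f (mon_of a) * g (mon_of b)).
Proof. exact: ps_mulE. Qed.

Lemma psr_oneE n : (1 : psr) n = (n == mon0 r)%:R.
Proof. by []. Qed.

Lemma psr_subE f g n : (f - g) n = f n - g n.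
Proof. by []. Qed.

Lemma psr_sumE (I : Type) (s : seq I) (P : pred I) (F : I -> psr) n :
  (\sum_(i <- s | P i) F i) n = \sum_(i <- s | P i) F i n.
Proof. exact: (big_morph (fun f : psr => f n)). Qed.

(** Every factor without constant term raises the total degree by at least 1. *)
Lemma psr_expr_eq0 f N n : f (mon0 r) = 0 -> (mon_deg n < N)%N -> (f ^+ N) n = 0.
Proof.
move=> f0; elim: N n => // N IH n nN; rewrite exprS.
have [D nD] := mon_bound n; rewrite (psr_mulE _ _ nD).
apply: big1 => a _; apply: big1 => b _.
have [abn|] := eqVneq; last by rewrite mul0r.
have [a0|a0] := eqVneq (mon_of a) (mon0 r); first by rewrite a0 f0 mul0r mulr0.
rewrite IH ?mulr0 // -ltnS; apply: leq_trans nN; rewrite ltnS.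
move/(congr1 (@mon_deg r)): abn; rewrite mon_degD => <-.
by rewrite -add1n leq_add2r lt0n mon_deg_eq0.
Qed.

Definition psr_cst (z : K) : psr := fun n => z * (n == mon0 r)%:R.

Lemma psr_cstE z f n : (psr_cst z * f) n = z * f n.
Proof.
have [D nD] := mon_bound n.
have e : f n = (1 * f) n by rewrite mul1r.
rewrite {}e !(psr_mulE _ _ nD) mulr_sumr; apply: eq_bigr => a _.
rewrite mulr_sumr; apply: eq_bigr => b _; rewrite /psr_cst psr_oneE.
by rewrite -mulrA mulrCA.
Qed.

(** Normalize the constant term to 1 and invert [k * f = 1 - u] by the geometric series in [u], a
    finite sum in each degree because [u] has no constant term. *)
Lemma psr_inv_ex f : f (mon0 r) != 0 -> exists g, f * g = 1.
Proof.
move=> f0; set k := psr_cst (f (mon0 r))^-1; pose u := 1 - k * f.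
have u0 : u (mon0 r) = 0 by rewrite /u psr_subE psr_cstE mulVf // psr_oneE eqxx subrr.
pose S N := k * \sum_(i < N) u ^+ i.
(* The truncation order depends on the coefficient. In the product it is replaced by the single
   order [(mon_deg n).+1]: the extra powers [u ^+ i], with [i > mon_deg b], have zero coefficient at
   [b]. *)
exists (fun n => S (mon_deg n).+1 n); apply/funext => n.
have -> : (1 : psr) n = (f * S (mon_deg n).+1) n.
  rewrite /S mulrA [f * k]mulrC -[k * f](subKr 1) -/u -[1 - u]opprB mulNr -subrX1 opprB.
  by rewrite psr_subE psr_expr_eq0 // subr0.
have [D nD] := mon_bound n; rewrite !(psr_mulE _ _ nD).
apply: eq_bigr => a _; apply: eq_bigr => b _.
have [abn|] := eqVneq; last by rewrite !mul0r.
congr (_ * (_ * _)); rewrite /S !psr_cstE !psr_sumE; congr (_ * _).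
have le_bn : (mon_deg (mon_of b) <= mon_deg n)%N.
  by move/(congr1 (@mon_deg r)): abn; rewrite mon_degD => <-; rewrite leq_addl.
rewrite -!(big_mkord xpredT (fun i => (u ^+ i) (mon_of b))).
rewrite [RHS](big_cat_nat (n := (mon_deg (mon_of b)).+1)) //= [X in _ + X]big_nat_cond.
by rewrite [X in _ + X]big1 ?addr0 // => i /andP[/andP[bi _] _]; rewrite psr_expr_eq0.
Qed.

Lemma ps_invP f : f (mon0 r) != 0 -> f * (ps_inv f : psr) = 1.
Proof.
move=> /psr_inv_ex[g fg]; rewrite /ps_inv.
by case: xgetP => [h _ /=|/(_ g)]; last by case.
Qed.

(* [psr_texp z c] is the series [z * exp (\sum_k c_k t_k)]. *)
Definition psr_texp (z : K) (c : 'I_r -> K) : psr :=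
  fun n => z * \prod_k (c k ^+ n k / (n k)`!%:R).

Lemma psr_texp0 z c : psr_texp z c (mon0 r) = z.
Proof.
by rewrite /psr_texp big1 ?mulr1 // => i _; rewrite ffunE expr0 fact0 divr1.
Qed.

Lemma psr_texp_cst z : psr_texp z (fun=> 0) = psr_cst z.
Proof.
apply/funext => n; rewrite /psr_texp /psr_cst eq_mon_prod; congr (_ * _).
apply: eq_bigr => i _; rewrite ffunE expr0n.
by case: (n i) => [|k]; rewrite ?fact0 ?divr1 ?mul0r.
Qed.

Hypothesis natrS_neq0 : forall n : nat, n.+1%:R != 0 :> K.

Lemma fact_neq0 m : m`!%:R != 0 :> K.
Proof. by rewrite -(prednK (fact_gt0 m)). Qed.

(** The binomial theorem in divided powers. Both indices run up to an arbitrary [D >= m] to match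
    the boxes of [ps_mulE]. *)
Lemma sum_binom_div_fact (x y : K) m D : (m <= D)%N ->
  \sum_(i < D.+1) \sum_(j < D.+1)
     ((i + j)%N == m)%:R * (x ^+ i / i`!%:R * (y ^+ j / j`!%:R)) =
  (x + y) ^+ m / m`!%:R.
Proof.
move=> mD; have -> : (x + y) ^+ m / m`!%:R =
   \sum_(i < m.+1) (x ^+ i / i`!%:R * (y ^+ (m - i) / (m - i)`!%:R)).
  rewrite addrC exprDn mulr_suml; apply: eq_bigr => i _.
  have im : (i <= m)%N by rewrite -ltnS ltn_ord.
  rewrite -mulr_natr -(bin_fact im) !natrM.
  have := fact_neq0 i; have := fact_neq0 (m - i).
  have : 'C(m, i)%:R != 0 :> K.
    by have := fact_neq0 m; rewrite -(bin_fact im) natrM mulf_eq0 => /norP[].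
  by move=> ? ? ?; field; apply/and3P.
rewrite (big_ord_widen D.+1 (fun i => x ^+ i / i`!%:R * (y ^+ (m - i) / (m - i)`!%:R))) //.
rewrite [RHS]big_mkcond; apply: eq_bigr => i _; case: ifPn => im.
  have miD : (m - i < D.+1)%N by rewrite ltnS (leq_trans _ mD) // leq_subr.
  rewrite (bigD1 (Ordinal miD)) //= subnKC // eqxx mul1r big1 ?addr0 // => j jm.
  case: eqP => [ijm|]; last by rewrite mul0r.
  by case/eqP: jm; apply: val_inj; rewrite /= -ijm addKn.
apply: big1 => j _; case: eqP => [ijm|]; last by rewrite mul0r.
by move: im; rewrite ltnS -ijm leq_addr.
Qed.

(** The Cauchy product splits over the variables, and in each variable it is the binomial
    theorem. *)
Lemma psr_texpM z w c d :
  psr_texp z c * psr_texp w d = psr_texp (z * w) (fun k => c k + d k).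
Proof.
apply/funext => n; have [D nD] := mon_bound n; rewrite (psr_mulE _ _ nD).
rewrite /psr_texp.
under [in RHS]eq_bigr => k _ do rewrite -(sum_binom_div_fact _ _ (nD k)).
rewrite bigA_distr_bigA /= mulr_sumr; apply: eq_bigr => a _.
rewrite bigA_distr_bigA /= mulr_sumr; apply: eq_bigr => b _.
rewrite [X in _ = _ * X]big_split /= [X in _ = _ * (_ * X)]big_split /= eq_mon_prod.
rewrite [X in _ * X = _]mulrACA [LHS]mulrCA.
by congr (_ * (_ * (_ * _))); apply: eq_bigr => i _; rewrite !ffunE.
Qed.

Lemma psr_texp1 : psr_texp 1 (fun=> 0) = 1.
Proof. by rewrite psr_texp_cst; apply/funext => n; rewrite /psr_cst mul1r. Qed.

Lemma psr_texpX z c N : psr_texp z c ^+ N = psr_texp (z ^+ N) (fun k => N%:R * c k).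
Proof.
elim: N => [|N IH].
  by rewrite !expr0 -psr_texp1; congr psr_texp; apply/funext => k; rewrite mul0r.
rewrite !exprS IH psr_texpM; congr psr_texp; apply/funext => k.
by rewrite -[in RHS]nat1r mulrDl mul1r.
Qed.

Lemma psr_texp_prod (I : finType) (z : I -> K) (c : I -> 'I_r -> K) :
  \prod_i psr_texp (z i) (c i) = psr_texp (\prod_i z i) (fun k => \sum_i c i k).
Proof.
have -> : (fun k => \sum_i c i k) = \sum_i c i.
  by apply/funext => k; rewrite fct_sumE.
apply: (big_ind3 (fun x y z => x = psr_texp y z)) => //.
  exact/esym/psr_texp1.
by move=> _ y1 c1 _ y2 c2 -> ->; rewrite psr_texpM.
Qed.

Lemma mon_deg_var (k : 'I_r) : mon_deg [ffun i => (i == k : nat)] = 1%N.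
Proof.
rewrite /mon_deg (bigD1 k) //= ffunE eqxx big1 // => i ik.
by rewrite ffunE (negPf ik).
Qed.

(* Euler's identity [(\sum_k c_k t_k) F = \sum_k t_k dF/dt_k] for [F = exp (\sum_k c_k t_k)]. *)
Lemma psr_texp_lin_mul (c : 'I_r -> K) n :
  (((fun n' => \sum_k c k * ps_var k n') : psr) * psr_texp 1 c) n =
  (mon_deg n)%:R * psr_texp 1 c n.
Proof.
have [D nD] := mon_bound n; rewrite (psr_mulE _ _ nD) /mon_deg natr_sum mulr_suml.
under eq_bigr => a _ do under eq_bigr => b _ do rewrite mulr_suml mulr_sumr.
under eq_bigr => a _ do rewrite exchange_big /=.
rewrite exchange_big /=; apply: eq_bigr => k _; rewrite exchange_big /=.
pose e : {ffun 'I_r -> nat} := [ffun i => (i == k : nat)].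
have -> : \sum_(b : {ffun 'I_r -> 'I_D.+1}) \sum_(a : {ffun 'I_r -> 'I_D.+1})
    (mon_add (mon_of a) (mon_of b) == n)%:R *
      (c k * ps_var k (mon_of a) * psr_texp 1 c (mon_of b)) =
    \sum_(b : {ffun 'I_r -> 'I_D.+1})
    (mon_add e (mon_of b) == n)%:R * (c k * psr_texp 1 c (mon_of b)).
  (* When [D = 0] the exponent [e] of the variable lies outside the box; then [e + b = n] is
     impossible and both sides vanish. *)
  have [[a aE]|noe] := pselect (exists a : {ffun 'I_r -> 'I_D.+1}, mon_of a = e).
    apply: eq_bigr => b _; rewrite (bigD1 a) //= aE /ps_var -/e eqxx mulr1.
    rewrite big1 ?addr0 // => a' a'a.
    by rewrite -aE (inj_eq (@mon_of_inj _ _)) (negPf a'a) mulr0 mul0r mulr0.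
  apply: eq_bigr => b _; rewrite big1 => [|a _].
    case: eqP => [ebn|]; last by rewrite mul0r.
    case: noe; apply: mon_ofP => i; apply: leq_trans (nD i).
    by rewrite -ebn [leqRHS]ffunE leq_addr.
  rewrite /ps_var -/e; case: (eqVneq _ e) => [aE|_]; last by rewrite mulr0 mul0r mulr0.
  by case: noe; exists a.
have [nk0|nk0] := eqVneq (n k) 0%N.
  rewrite nk0 mul0r big1 // => b _; case: eqP => [ebn|]; last by rewrite mul0r.
  by move: nk0; rewrite -ebn !ffunE eqxx.
(* The only contribution comes from [b0 = n - e]; the truncated subtraction is exact because [n k]
   is positive here. *)
have [b0 b0E] : exists b : {ffun 'I_r -> 'I_D.+1}, mon_of b = [ffun i => (n i - e i)%N].
  by apply: mon_ofP => i; rewrite ffunE (leq_trans _ (nD i)) // leq_subr.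
have eb0 : mon_add e (mon_of b0) = n.
  apply/ffunP => i; rewrite b0E !ffunE subnKC //.
  by case: eqP => [->|//]; rewrite lt0n.
rewrite (bigD1 b0) //= eb0 eqxx mul1r big1 ?addr0 => [|b bb0]; last first.
  case: eqP => [ebn|]; last by rewrite mul0r.
  case/eqP: bb0; apply: (@mon_of_inj r D); apply/ffunP => i.
  apply: (@addnI (e i)); move/ffunP: ebn => /(_ i); move/ffunP: eb0 => /(_ i).
  by rewrite !ffunE => -> ->.
rewrite /psr_texp !mul1r (bigD1 k) //= [in RHS](bigD1 k) //= !mulrA; congr (_ * _).
  rewrite b0E !ffunE eqxx subn1; case: (n k) nk0 => // m _.
  have := fact_neq0 m; have := natrS_neq0 m; rewrite /= factS natrM exprS.
  by move: (m.+1%:R) => q q0 m0; field; apply/andP.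
by apply: eq_bigr => i ik; rewrite b0E !ffunE (negPf ik) subn0.
Qed.

(** The multinomial theorem, obtained by induction from Euler's identity instead of multinomial
    coefficients. *)
Lemma psr_lin_exp (c : 'I_r -> K) N n :
  (((fun n' => \sum_k c k * ps_var k n') : psr) ^+ N) n =
  (mon_deg n == N)%:R * (N`!%:R * psr_texp 1 c n).
Proof.
elim: N n => [|N IH] n.
  rewrite expr0 psr_oneE mon_deg_eq0; case: eqP => [->|_]; last by rewrite mul0r.
  by rewrite psr_texp0 fact0 !mulr1.
have [D nD] := mon_bound n.
rewrite exprS factS natrM.
have -> : (mon_deg n == N.+1)%:R * (N.+1%:R * N`!%:R * psr_texp 1 c n) =
    (mon_deg n == N.+1)%:R * (N`!%:R * ((mon_deg n)%:R * psr_texp 1 c n)).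
  by case: eqP => [->|_]; rewrite ?mul0r // !mul1r; ring.
rewrite -psr_texp_lin_mul !(psr_mulE _ _ nD) 2!mulr_sumr.
apply: eq_bigr => a _; rewrite 2!mulr_sumr; apply: eq_bigr => b _.
rewrite IH; case: (eqVneq _ n) => [abn|]; last by rewrite !(mul0r, mulr0).
(* A linear form lives in degree 1. There [b] has degree [N] exactly when [n] has degree [N.+1], so
   the indicator can be moved from [b] to [n]. *)
have [a1|a1] := eqVneq (mon_deg (mon_of a)) 1%N.
  by rewrite -{1}abn mon_degD a1 add1n eqSS; ring.
rewrite big1 ?(mul0r, mulr0) // => k _; rewrite /ps_var.
by case: eqP => [aE|]; rewrite ?mulr0 //; case/eqP: a1; rewrite aE mon_deg_var.
Qed.

Lemma iter_ps_mul f N : iter N (ps_mul f) (@ps_one K r) = f ^+ N.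
Proof. by elim: N => //= N ->; rewrite exprS. Qed.

(** In the truncated sum that defines [ps_exp], only the last term, [N = mon_deg n], can be nonzero
    at [n]. *)
Lemma ps_exp_lin (c : 'I_r -> K) :
  ps_exp (fun n => \sum_k c k * ps_var k n) = psr_texp 1 c.
Proof.
apply/funext => n; rewrite /ps_exp big_ord_recr /= big1 => [|N _].
  rewrite add0r iter_ps_mul psr_lin_exp eqxx mul1r mulrAC mulfV ?mul1r //.
  exact: fact_neq0.
rewrite iter_ps_mul psr_lin_exp; case: eqP => [e|]; last by rewrite !mul0r.
by have := ltn_ord N; rewrite -[X in (_ < X)%N]/(mon_deg n) e ltnn.
Qed.

Lemma ps_var_sum (g : K) (j : 'I_r) :
  (fun n => g * \sum_(k < r | (j <= k)%N) ps_var k n) =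
  (fun n => \sum_(k < r) (if (j <= k)%N then g else 0) * ps_var k n).
Proof.
apply/funext => n; rewrite big_mkcond mulr_sumr; apply: eq_bigr => k _.
by case: ifP; rewrite ?mulr0 ?mul0r.
Qed.

Lemma twisted_genE (z gamma : 'I_r -> K) :
  twisted_gen z gamma =
  \prod_j (ps_inv (1 - psr_texp (z j) (fun k => if (j <= k)%N then gamma j else 0)) : psr).
Proof.
apply: eq_bigr => j _; congr ps_inv; apply/funext => n.
rewrite ps_var_sum ps_exp_lin psr_subE; congr (_ - _).
by rewrite /psr_texp mul1r.
Qed.

(* Both sides are the generating series of a Riemann sum: multiply
   [\sum_(a < P) x ^+ a = (1 - x ^+ P) / (1 - x)] over [j], for
   [x = z_j exp(gamma_j \sum_(k >= j) t_k)]. *)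
Lemma twisted_gen_sum (z gamma : 'I_r -> K) P : (forall j, z j ^+ P != 1) ->
  (twisted_gen z gamma : psr) *
    \prod_j (psr_cst (1 - z j ^+ P)^-1 *
      (1 - psr_texp (z j ^+ P) (fun k => P%:R * if (j <= k)%N then gamma j else 0))) =
  \sum_(a : {ffun 'I_r -> 'I_P})
     psr_texp (\prod_j (z j ^+ a j / (1 - z j ^+ P)))
       (fun k => \sum_j (a j)%:R * if (j <= k)%N then gamma j else 0).
Proof.
move=> zP; rewrite twisted_genE -big_split /=.
transitivity (\prod_j (psr_cst (1 - z j ^+ P)^-1 *
    \sum_(i < P) psr_texp (z j) (fun k => if (j <= k)%N then gamma j else 0) ^+ i)).
  apply: eq_bigr => j _; rewrite -psr_texpX mulrCA; congr (_ * _).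
  set x := psr_texp _ _; rewrite -[1 - x ^+ P]opprB subrX1 -mulNr opprB mulrA.
  rewrite [X in X * _]mulrC ps_invP ?mul1r //.
  (* The constant term is [1 - z j], and [z j = 1] would force [z j ^+ P = 1]; so [ps_inv] is a true
     inverse and not its default value. *)
  rewrite psr_subE /x psr_texp0 psr_oneE eqxx subr_eq0 eq_sym.
  by apply: contraNneq (zP j) => ->; rewrite expr1n.
under eq_bigr => j _ do rewrite mulr_sumr.
rewrite bigA_distr_bigA; apply: eq_bigr => a _ /=; rewrite -psr_texp_prod.
apply: eq_bigr => j _; rewrite -psr_texp_cst psr_texpX psr_texpM mulrC.
by congr psr_texp; apply/funext => k; rewrite add0r.
Qed.

Lemma psr_texp_coef z c (n : 'I_r -> nat) :
  (\prod_i (n i)`!)%:R * psr_texp z c [ffun i => n i] = z * \prod_k c k ^+ n k.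
Proof.
rewrite /psr_texp mulrCA natr_prod -big_split; congr (_ * _).
by apply: eq_bigr => k _ /=; rewrite ffunE mulrCA mulfV ?mulr1 // fact_neq0.
Qed.

End PowerSeriesRing.

(** * Roots of unity *)

Section RootsOfUnity.
Variable K : closedFieldType.

(** As [c] is nonzero in [K], the polynomial [X^c - 1] is separable and has [c] distinct roots; such
    a group of roots contains a generator. *)
Lemma prim_root_exists c : (0 < c)%N -> c%:R != 0 :> K ->
  exists w : K, c.-primitive_root w.
Proof.
move=> c0 cK; have [rs rsE] := closed_field_poly_normal ('X^c - 1 : {poly K}).
have c1 : ('X^c - 1 : {poly K}) \is monic by rewrite monicXnsubC.
rewrite (monicP c1) scale1r in rsE.
have urs : uniq rs by rewrite -separable_prod_XsubC -rsE separable_Xn_sub_1.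
have srs : size rs = c.
  by apply: succn_inj; rewrite -(size_prod_XsubC rs id) -rsE size_XnsubC.
have : has c.-primitive_root rs.
  apply: has_prim_root => //; last by rewrite srs.
  by apply/allP => x; rewrite -root_prod_XsubC -rsE.
by move=> /hasP[w _ wp]; exists w.
Qed.

Lemma roots_bij c (w : K) : c.-primitive_root w ->
  set_bij [set: 'I_c] [set x : K | x ^+ c = 1] (fun i : 'I_c => w ^+ i).
Proof.
move=> wp; split.
- by move=> i _ /=; rewrite exprAC (prim_expr_order wp) expr1n.
- move=> i j _ _ /= /eqP; rewrite (eq_prim_root_expr wp) !modn_small //.
  by move=> /eqP ij; apply: val_inj.
- by move=> x /= /(prim_rootP wp)[i ->]; exists i.
Qed.

(** Exponent 0 would give the trivial root, hence the shift [i.+1] with [i] below [c.-1]. *)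
Lemma nontriv_roots_bij c (w : K) : c.-primitive_root w ->
  set_bij [set: 'I_c.-1] (@nontriv_roots K c) (fun i : 'I_c.-1 => w ^+ i.+1).
Proof.
move=> wp; have c0 := prim_order_gt0 wp.
have lt_c (i : 'I_c.-1) : (i.+1 < c)%N by rewrite -ltn_predRL.
split.
- move=> i _; split => /=; first by rewrite exprAC (prim_expr_order wp) expr1n.
  move/eqP; rewrite -(prim_order_dvd wp) => /dvdn_leq -/(_ isT).
  by rewrite leqNgt lt_c.
- move=> i j _ _ /= /eqP; rewrite (eq_prim_root_expr wp) !modn_small //.
  by move=> /eqP [ij]; apply: val_inj.
- move=> x [/(prim_rootP wp)[[[|i] ic] ->]] //= _.
  have ic' : (i < c.-1)%N by rewrite ltn_predRL.
  by exists (Ordinal ic').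
Qed.

Lemma sum_unity_powers c (x : K) : x ^+ c = 1 ->
  \sum_(i < c) x ^+ i = if x == 1 then c%:R else 0.
Proof.
move=> xc; case: eqP => [->|/eqP x1].
  by rewrite (eq_bigr (fun=> 1)) ?sumr_const ?card_ord // => i _; rewrite expr1n.
have := subrX1 x c; rewrite xc subrr => /esym/eqP.
by rewrite mulf_eq0 subr_eq0 (negPf x1) => /eqP.
Qed.

(** Multiplying the sum by [1 - x] telescopes to a vanishing sum of powers minus [c]. The formula
    makes [1 / (1 - x)] integral as soon as [c] is a p-adic unit. *)
Lemma inv_1subr_unity c (x : K) : c%:R != 0 :> K -> x ^+ c = 1 -> x != 1 ->
  (1 - x)^-1 = - c%:R^-1 * \sum_(i < c) i%:R * x ^+ i.
Proof.
move=> c0 xc x1.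
have E n : (1 - x) * \sum_(i < n) i%:R * x ^+ i = x * \sum_(i < n) x ^+ i - n%:R * x ^+ n.
  elim: n => [|n IH]; first by rewrite !big_ord0 !mulr0 mul0r subrr.
  by rewrite !big_ord_recr /= !mulrDr IH exprS -[n.+1%:R]natr1; ring.
have := E c; rewrite sum_unity_powers // (negPf x1) xc mulr0 mulr1 add0r => {}E.
have x1' : 1 - x != 0 by rewrite subr_eq0 eq_sym.
by apply: (mulfI x1'); rewrite mulrCA E mulfV // mulrNN mulVf.
Qed.

Lemma fsum_ffun_reindex (I J : finType) (T : choiceType) (A : set T) (g : J -> T)
    (F : {ffun I -> T} -> K) : set_bij setT A g ->
  \sum_(x \in [set x : {ffun I -> T} | forall i, A (x i)]) F x =
  \sum_(f : {ffun I -> J}) F [ffun i => g (f i)].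
Proof.
move=> [gA ginj gsurj]; pose h (f : {ffun I -> J}) := [ffun i => g (f i)] : {ffun I -> T}.
rewrite (@fsum_reindex _ _ _ _ h) //; split.
- by move=> f _ i; rewrite ffunE; exact: gA.
- move=> f f' _ _ /ffunP ff; apply/ffunP => i; apply: ginj; rewrite ?in_setT //.
  by move: (ff i); rewrite !ffunE.
- move=> x Ax; have k i := cid2 (gsurj (x i) (Ax i)).
  exists [ffun i => s2val (k i)] => //; apply/ffunP => i; rewrite !ffunE.
  by case: (k i).
Qed.

End RootsOfUnity.

(** * p-adic integers *)

Section Padic.
Context {R : realType} {K : closedFieldType} (p : nat) (absp : K -> R).
Hypotheses (hp : prime p) (hCp : is_Cp p absp).
Local Notation padicZ := (padicZ absp).

Let p_gt0 : (0 < p)%N := prime_gt0 hp.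
Let pR_gt0 : 0 < p%:R :> R. Proof. by rewrite ltr0n. Qed.
Let pR_gt1 : 1 < p%:R :> R. Proof. by rewrite ltr1n prime_gt1. Qed.

Lemma abs0 : absp 0 = 0. Proof. exact/(absp_eq0 hCp). Qed.

Lemma abs_eq0 x : (absp x == 0) = (x == 0).
Proof. by apply/eqP/eqP => /(absp_eq0 hCp). Qed.

Lemma abs1 : absp 1 = 1.
Proof.
have : absp 1 * absp 1 = absp 1 * 1 by rewrite -(abspM hCp) !mulr1.
by apply: mulfI; rewrite abs_eq0 oner_neq0.
Qed.

Lemma absX x n : absp (x ^+ n) = absp x ^+ n.
Proof. by elim: n => [|n IH]; rewrite ?abs1 // !exprS (abspM hCp) IH. Qed.

Lemma absN x : absp (- x) = absp x.
Proof.
have : absp (-1) ^+ 2 == 1 by rewrite -absX sqrrN expr1n abs1.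
rewrite sqrf_eq1 => /orP[/eqP N1|/eqP N1]; first by rewrite -mulN1r (abspM hCp) N1 mul1r.
by have := absp_ge0 hCp (-1); rewrite N1 ler0N1.
Qed.

Lemma absB x y : absp (x - y) = absp (y - x).
Proof. by rewrite -absN opprB. Qed.

Lemma absV x : absp x^-1 = (absp x)^-1.
Proof.
have [->|x0] := eqVneq x 0; first by rewrite !invr0 abs0 invr0.
have x0' : absp x != 0 by rewrite abs_eq0.
by apply: (mulfI x0'); rewrite -(abspM hCp) !mulfV // abs1.
Qed.

Lemma absD_le x y e : absp x <= e -> absp y <= e -> absp (x + y) <= e.
Proof. by move=> xe ye; apply: le_trans (abspD hCp x y) _; rewrite ge_max xe. Qed.

Lemma absB_le x y e : absp x <= e -> absp y <= e -> absp (x - y) <= e.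
Proof. by move=> xe ye; apply: absD_le; rewrite ?absN. Qed.

Lemma absD_lt x y e : absp x < e -> absp y < e -> absp (x + y) < e.
Proof. by move=> xe ye; apply: le_lt_trans (abspD hCp x y) _; rewrite gt_max xe. Qed.

Lemma absM_le1 x y e : absp x <= 1 -> absp y <= e -> absp (x * y) <= e.
Proof.
by move=> x1 ye; rewrite (abspM hCp) -[e]mul1r ler_pM // (absp_ge0 hCp).
Qed.

Lemma abs_sum_le (I : Type) (s : seq I) (P : pred I) (F : I -> K) e : 0 <= e ->
  (forall i, P i -> absp (F i) <= e) -> absp (\sum_(i <- s | P i) F i) <= e.
Proof.
move=> e0 Fe; apply: (big_ind (fun x => absp x <= e)) => //; first by rewrite abs0.
by move=> x y; exact: absD_le.
Qed.

Lemma abs_nat n : absp n%:R <= 1.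
Proof.
elim: n => [|n IH]; first by rewrite abs0.
by rewrite -natr1 absD_le // abs1.
Qed.

Lemma abs_pX k : absp (p%:R ^+ k) = p%:R ^- k.
Proof. by rewrite absX (absp_p hCp) exprVn. Qed.

Lemma pXV_gt0 k : 0 < p%:R ^- k :> R.
Proof. by rewrite invr_gt0 exprn_gt0. Qed.

(** In a Bezout relation [1 = u n - v p], a value [|n| < 1] would make both terms, hence 1 itself,
    smaller than 1. *)
Lemma abs_coprime n : coprime n p -> absp n%:R = 1.
Proof.
have [->|n0] := posnP n; first by rewrite /coprime gcd0n => /eqP e; move: hp; rewrite e.
move=> np; apply/eqP; rewrite eq_le abs_nat /= leNgt; apply/negP => n1.
have [u v uv _] := egcdnP p n0.
have : absp 1 < 1; last by rewrite abs1 ltxx.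
have -> : 1 = u%:R * n%:R - v%:R * p%:R :> K.
  by rewrite -!natrM uv (eqP np) natrD addrAC subrr add0r.
apply: absD_lt; rewrite ?absN (abspM hCp).
  by apply: le_lt_trans n1; rewrite ler_piMl ?(absp_ge0 hCp) // abs_nat.
rewrite (absp_p hCp); apply: (@le_lt_trans _ _ (1 * p%:R^-1)).
  by rewrite ler_wpM2r ?abs_nat // invr_ge0 ltW.
by rewrite mul1r invf_lt1.
Qed.

Lemma abs_natE n : (0 < n)%N -> absp n%:R = p%:R ^- logn p n.
Proof.
move=> n0; have [m mp nE] := pfactor_coprime hp n0.
by rewrite {1}nE natrM natrX (abspM hCp) abs_pX abs_coprime ?mul1r // coprime_sym.
Qed.

Lemma abs_nat_le k n : (absp n%:R <= p%:R ^- k) = (p ^ k %| n)%N.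
Proof.
have [->|n0] := posnP n; first by rewrite abs0 dvdn0 ltW // pXV_gt0.
rewrite abs_natE // pfactor_dvdn // lef_pV2 ?posrE ?exprn_gt0 //.
by rewrite ler_eXn2l.
Qed.

Lemma natrS_neq0 n : n.+1%:R != 0 :> K.
Proof. by rewrite -abs_eq0 abs_natE // gt_eqF // pXV_gt0. Qed.

Lemma natr_gt0_neq0 n : (0 < n)%N -> n%:R != 0 :> K.
Proof. by case: n => // n _; exact: natrS_neq0. Qed.

Lemma pXV_small e : 0 < e -> exists N, p%:R ^- N < e :> R.
Proof.
move=> e0; have [N Ne] : exists N : nat, e^-1 < N%:R.
  by exists (Num.truncn e^-1).+1; rewrite truncnS_gt.
exists N; rewrite -[e]invrK ltf_pV2 ?posrE ?exprn_gt0 ?invr_gt0 //.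
by apply: lt_trans Ne _; rewrite -natrX ltr_nat ltn_expl // prime_gt1.
Qed.

Lemma abs_modn_sub k a b : a = b %[mod p ^ k] -> absp (a%:R - b%:R) <= p%:R ^- k.
Proof.
wlog ba : a b / (b <= a)%N => [th|/eqP].
  by have [/th//|/ltnW/th ab /esym/ab] := leqP b a; rewrite absB.
by rewrite eqn_mod_dvd // -natrB // abs_nat_le.
Qed.

Lemma abs_intE (z : int) : absp (z%:~R) = absp ((`|z|%N)%:R).
Proof. by case: z => n; rewrite ?NegzE ?mulrNz ?absN ?absz_nat //= abszN. Qed.

Lemma int_approx (z : int) N : exists a : nat, absp (z%:~R - a%:R) <= p%:R ^- N.
Proof.
case: z => n; first by exists n; rewrite subrr abs0 ltW // pXV_gt0.
(* [Negz n] is [-(n + 1)], and adding the multiple [(n + 1) p^N] makes it nonnegative. *)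
exists (n.+1 * (p ^ N - 1))%N.
have -> : (Negz n)%:~R - (n.+1 * (p ^ N - 1))%:R = - n.+1%:R * p%:R ^+ N :> K.
  by rewrite NegzE mulrNz natrM natrB ?expn_gt0 ?p_gt0 // natrX; ring.
by apply: absM_le1; rewrite ?absN ?abs_nat // abs_pX.
Qed.

(** The natural numbers are dense in the p-adic integers. This is the working criterion from which
    all closure properties below follow. *)
Lemma padicZP x : padicZ x <-> forall N, exists a : nat, absp (x - a%:R) <= p%:R ^- N.
Proof.
split=> [[xQ x1] N|xa]; last first.
  split.
    move=> e /pXV_small[N Ne]; have [a xaN] := xa N.
    by exists a%:R; rewrite ratr_nat; exact: le_lt_trans Ne.
  have [a xa0] := xa 0%N; rewrite -(subrK a%:R x); apply: absD_le; last exact: abs_nat.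
  by rewrite expr0 invr1 in xa0.
have [a xaN] := xQ _ (pXV_gt0 N).
have p_le1 : p%:R ^- N <= 1 :> R by rewrite invf_le1 ?exprn_gt0 // exprn_ege1 // ltW.
have a1 : absp (ratr a) <= 1.
  by rewrite -(subKr x (ratr a)); apply: absB_le => //; apply: le_trans p_le1; rewrite ltW.
set D := `|denq a|%N; have D0 : (0 < D)%N by rewrite absz_gt0 denq_neq0.
have aE : ratr a = (numq a)%:~R / D%:R :> K.
  by rewrite /ratr -{1}(gez0_abs (ltW (denq_gt0 a))).
(* If [p] divided the denominator, [|a| <= 1] would force it to divide the numerator too, against
   lowest terms. *)
have Dp : coprime D p.
  rewrite coprime_sym prime_coprime //; apply/negP => pD.
  have uD : absp ((numq a)%:~R) <= absp D%:R.
    rewrite -(divfK (natr_gt0_neq0 D0) (numq a)%:~R) -aE.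
    exact: absM_le1.
  have pu : (p %| `|numq a|)%N.
    rewrite -[p]expn1 -abs_nat_le -abs_intE; apply: le_trans uD _.
    by rewrite abs_nat_le expn1.
  have := coprime_num_den a; rewrite -/D => /coprime_dvdl -/(_ _ pu).
  by move=> /coprime_dvdr -/(_ _ pD); rewrite /coprime gcdnn => /eqP e; move: hp; rewrite e.
have [u v uv _] := egcdnP (p ^ N) D0.
rewrite (eqP (coprimeXr N Dp)) in uv.
(* Here [u] inverts the denominator modulo [p^N], so [numq a * u] is an integer close to [a]; a
   natural number close to it is taken. *)
have [b bE] := int_approx (numq a * u%:Z) N.
exists b; rewrite -(subrK (ratr a) x) -addrA; apply: absD_le; first exact: ltW.
rewrite -(subrK (numq a * u%:Z)%:~R (ratr a)) -addrA; apply: absD_le => //.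
have -> : ratr a - (numq a * u%:Z)%:~R = (ratr a * - v%:R) * p%:R ^+ N :> K.
  have -> : ratr a * - v%:R * p%:R ^+ N = ratr a * - (v * p ^ N)%:R :> K.
    by rewrite natrM natrX; ring.
  have -> : (v * p ^ N)%:R = (u * D)%:R - 1 :> K by rewrite uv natrD addrK.
  rewrite aE natrM rmorphM /=; field; exact: natr_gt0_neq0.
apply: absM_le1; last by rewrite abs_pX.
by apply: absM_le1; rewrite // absN abs_nat.
Qed.

Lemma padicZ_nat n : padicZ n%:R.
Proof.
by apply/padicZP => N; exists n; rewrite subrr abs0 ltW // pXV_gt0.
Qed.

Lemma padicZ_int (z : int) : padicZ z%:~R.
Proof. by apply/padicZP => N; exact: int_approx. Qed.

Lemma padicZ_le1 x : padicZ x -> absp x <= 1.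
Proof. by case. Qed.

Lemma padicZD x y : padicZ x -> padicZ y -> padicZ (x + y).
Proof.
move=> /padicZP xZ /padicZP yZ; apply/padicZP => N.
have [[a xa] [b yb]] := (xZ N, yZ N); exists (a + b)%N.
by rewrite natrD opprD addrACA absD_le.
Qed.

Lemma padicZM x y : padicZ x -> padicZ y -> padicZ (x * y).
Proof.
move=> /[dup] /padicZP xZ [_ x1] /padicZP yZ; apply/padicZP => N.
have [[a xa] [b yb]] := (xZ N, yZ N); exists (a * b)%N.
have -> : x * y - (a * b)%:R = x * (y - b%:R) + b%:R * (x - a%:R).
  by rewrite natrM; ring.
by apply: absD_le; apply: absM_le1 => //; exact: abs_nat.
Qed.

Lemma padicZN x : padicZ x -> padicZ (- x).
Proof. by move=> xZ; rewrite -mulN1r; apply: padicZM => //; exact: (padicZ_int (-1)). Qed.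

Lemma padicZB x y : padicZ x -> padicZ y -> padicZ (x - y).
Proof. by move=> xZ yZ; apply: padicZD => //; exact: padicZN. Qed.

Lemma padicZ_sum (I : Type) (s : seq I) (P : pred I) (F : I -> K) :
  (forall i, P i -> padicZ (F i)) -> padicZ (\sum_(i <- s | P i) F i).
Proof.
move=> FZ; apply: (big_ind padicZ) => //; first exact: (padicZ_nat 0).
exact: padicZD.
Qed.

Lemma padicZ_prod (I : Type) (s : seq I) (P : pred I) (F : I -> K) :
  (forall i, P i -> padicZ (F i)) -> padicZ (\prod_(i <- s | P i) F i).
Proof.
move=> FZ; apply: (big_ind padicZ) => //; first exact: (padicZ_nat 1).
exact: padicZM.
Qed.

Lemma padicZX x n : padicZ x -> padicZ (x ^+ n).
Proof.
move=> xZ; elim: n => [|n IH]; first exact: (padicZ_nat 1).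
by rewrite exprS; exact: padicZM.
Qed.

Lemma padicZV n : coprime n p -> padicZ n%:R^-1.
Proof.
move=> np; apply/padicZP => N.
have [n0|n0] := posnP n.
  by move: np hp; rewrite n0 /coprime gcd0n => /eqP ->.
have [u v uv _] := egcdnP (p ^ N) n0; exists u.
rewrite (eqP (coprimeXr N np)) in uv.
have -> : n%:R^-1 - u%:R = n%:R^-1 * - v%:R * p%:R ^+ N :> K.
  have -> : n%:R^-1 * - v%:R * p%:R ^+ N = - (n%:R^-1 * (v * p ^ N)%:R) :> K.
    by rewrite natrM natrX mulrN mulNr mulrA.
  have -> : (v * p ^ N)%:R = (u * n)%:R - 1 :> K by rewrite uv natrD addrK.
  by rewrite natrM; field; exact: natr_gt0_neq0.
apply: absM_le1; last by rewrite abs_pX.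
by apply: absM_le1; rewrite ?absV ?abs_coprime ?invr1 // absN abs_nat.
Qed.

(** Turns divisibility into an estimate. Conversely, a natural number close enough to [x] is
    divisible by [p^k], and its quotient approximates [x / p^k]. *)
Lemma pdvdP k x : padicZ x -> pdvd p absp k x <-> absp x <= p%:R ^- k.
Proof.
move=> xZ; split=> [[z [zZ ->]]|xk].
  by rewrite mulrC absM_le1 ?abs_pX //; exact: padicZ_le1.
have pk0 : p%:R ^+ k != 0 :> K by rewrite expf_neq0 // natr_gt0_neq0.
exists (x / p%:R ^+ k); split; last by rewrite mulrC divfK.
(* The [k] extra digits are those lost on division by [p^k]. *)
apply/padicZP => N; have /padicZP/(_ (N + k)%N)[a xa] := xZ.
have : absp a%:R <= p%:R ^- k.
  rewrite -(subKr x a%:R); apply: absB_le => //; apply: le_trans xa _.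
  by rewrite lef_pV2 ?posrE ?exprn_gt0 // ler_eXn2l // leq_addl.
rewrite abs_nat_le => /dvdnP[b aE]; exists b.
have -> : x / p%:R ^+ k - b%:R = (x - a%:R) / p%:R ^+ k.
  by rewrite aE natrM natrX mulrBl mulfK.
rewrite (abspM hCp) absV abs_pX invrK; apply: le_trans (ler_wpM2r _ xa) _.
  by rewrite exprn_ge0 // ltW.
by rewrite exprD invfM mulfVK // expf_neq0 // gt_eqF.
Qed.

Lemma congrZpP k x y : padicZ x -> padicZ y -> absp (x - y) <= p%:R ^- k ->
  congrZp p absp k x y.
Proof. by move=> xZ yZ xyk; split=> //; apply/pdvdP => //; exact: padicZB. Qed.

Lemma abs_exp_sub x y n : absp x <= 1 -> absp y <= 1 -> absp (x ^+ n - y ^+ n) <= absp (x - y).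
Proof.
move=> x1 y1; rewrite subrXX mulrC; apply: absM_le1 => //.
apply: abs_sum_le => // i _; rewrite (abspM hCp) !absX.
by rewrite mulr_ile1 ?exprn_ge0 ?exprn_ile1 ?(absp_ge0 hCp).
Qed.

Lemma expn_mod_totient a m n q : coprime a q ->
  m = n %[mod totient q] -> a ^ m = a ^ n %[mod q].
Proof.
move=> aq mn.
have E k : a ^ k = a ^ (k %% totient q) %[mod q].
  rewrite {1}(divn_eq k (totient q)) expnD [(k %/ _ * _)%N]mulnC expnM -modnMml -modnXm.
  by rewrite Euler_exp_totient // modnXm exp1n modnMml mul1n.
by rewrite E mn -E.
Qed.

(** Replace [x] by a natural number congruent to it modulo [p^l]; that number is prime to [p], and
    Euler's theorem applies because the modulus of the exponents is the totient of [p^l]. *)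
Lemma abs_unit_exp_sub x l m n : padicZ x -> ~~ (absp x <= p%:R ^- 1) ->
  (0 < l)%N -> m = n %[mod (p - 1) * p ^ (l - 1)] ->
  absp (x ^+ m - x ^+ n) <= p%:R ^- l.
Proof.
move=> xZ x1 l0; rewrite !subn1 -totient_pfactor // => mn.
have /padicZP/(_ l)[a xa] := xZ.
have ap : coprime a p.
  rewrite coprime_sym prime_coprime //; apply: contra x1; rewrite -[p in (p %| _)%N]expn1.
  rewrite -abs_nat_le => a1; rewrite -(subrK a%:R x); apply: absD_le => //.
  by apply: le_trans xa _; rewrite lef_pV2 ?posrE ?exprn_gt0 // ler_eXn2l.
have e k : absp (x ^+ k - a%:R ^+ k) <= p%:R ^- l.
  by apply: le_trans xa; apply: abs_exp_sub; rewrite ?abs_nat ?padicZ_le1.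
rewrite -(subrK (a%:R ^+ m) (x ^+ m)) -addrA; apply: absD_le => //.
rewrite -(subrK (a%:R ^+ n) (a%:R ^+ m)) -addrA; apply: absD_le; last by rewrite absB.
by have := abs_modn_sub (expn_mod_totient (coprimeXr l ap) mn); rewrite !natrX.
Qed.

(** One factor is changed at a time; the bounds by 1 on the partial products are carried through the
    same induction. *)
Lemma abs_prod_sub (I : finType) (F G : I -> K) e : 0 <= e ->
  (forall i, absp (F i) <= 1) -> (forall i, absp (G i) <= 1) ->
  (forall i, absp (F i - G i) <= e) -> absp (\prod_i F i - \prod_i G i) <= e.
Proof.
move=> e0 F1 G1 FG.
suff: [/\ absp (\prod_i F i) <= 1, absp (\prod_i G i) <= 1
        & absp (\prod_i F i - \prod_i G i) <= e] by case.
apply: (big_rec2 (fun x y => [/\ absp x <= 1, absp y <= 1 & absp (x - y) <= e])).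
  by rewrite subrr abs0 abs1; split.
move=> i x y _ [x1 y1 xy]; split; try exact: absM_le1.
have -> : F i * x - G i * y = F i * (x - y) + y * (F i - G i) by ring.
by apply: absD_le; exact: absM_le1.
Qed.

End Padic.

(** * Inclusion-exclusion *)

Section InclusionExclusion.
Variable K : comPzRingType.

Definition incr d r (i : {ffun 'I_d -> 'I_r}) : bool :=
  [forall a : 'I_d, forall b : 'I_d, (a < b)%N ==> (i a < i b)%N].

Lemma incr_inj d r (i : {ffun 'I_d -> 'I_r}) : incr i -> injective i.
Proof.
move=> /forallP ii a b iab; apply: val_inj; apply/eqP.
have /forallP/(_ b)/implyP ab := ii a; have /forallP/(_ a)/implyP ba := ii b.
case: ltngtP => // [/ab|/ba]; by rewrite iab ltnn.
Qed.

Lemma sorted_enum_ord r : sorted (fun x y : 'I_r => (x < y)%N) (enum 'I_r).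
Proof. by have := iota_ltn_sorted 0 r; rewrite -val_enum_ord sorted_map. Qed.

Lemma sorted_enum_set r (J : {set 'I_r}) : sorted (fun x y : 'I_r => (x < y)%N) (enum J).
Proof.
have -> : enum J = [seq x <- enum 'I_r | x \in J] by rewrite enumT.
by apply: sorted_filter (sorted_enum_ord r) => y x z; exact: ltn_trans.
Qed.

(** Two strictly sorted lists with the same elements coincide, so an increasing tuple is recovered
    from its image. *)
Lemma enum_incr d r (i : {ffun 'I_d -> 'I_r}) : incr i ->
  enum [set i l | l : 'I_d] = [seq i l | l <- enum 'I_d].
Proof.
move=> ii; apply: (@irr_sorted_eq _ (fun x y : 'I_r => (x < y)%N)).
- by move=> y x z; exact: ltn_trans.
- by move=> x; rewrite ltnn.
- exact: sorted_enum_set.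
- rewrite sorted_map; apply: sub_sorted (sorted_enum_ord d) => a b ab /=.
  by have /forallP/(_ b)/implyP := forallP ii a; apply.
- move=> x; rewrite mem_enum; apply/imsetP/mapP => -[l _ ->]; exists l => //.
  by rewrite mem_enum.
Qed.

(** Subsets of size [d] correspond to increasing [d]-tuples by listing their elements in order. [x0]
    is the default of [nth], never reached for sets of size [d]. *)
Lemma sum_incr_prod d r (x0 : 'I_r) (B : 'I_r -> K) :
  \sum_(J : {set 'I_r} | #|J| == d) \prod_(k in J) B k =
  \sum_(i : {ffun 'I_d -> 'I_r} | incr i) \prod_(l < d) B (i l).
Proof.
pose h' (J : {set 'I_r}) : {ffun 'I_d -> 'I_r} := [ffun l => nth x0 (enum J) (val l)].
pose h (i : {ffun 'I_d -> 'I_r}) : {set 'I_r} := [set i l | l : 'I_d].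
have hK (J : {set 'I_r}) : #|J| == d -> h (h' J) = J.
  move=> /eqP Jd; apply/setP => x; apply/imsetP/idP => [[l _ ->]|xJ].
    by rewrite ffunE -mem_enum mem_nth // -cardE Jd ltn_ord.
  have xd : (index x (enum J) < d)%N by rewrite -Jd cardE index_mem mem_enum.
  by exists (Ordinal xd); rewrite // ffunE /= nth_index // mem_enum.
have h'incr (J : {set 'I_r}) : #|J| == d -> incr (h' J).
  move=> /eqP Jd; apply/forallP => a; apply/forallP => b; apply/implyP => ab.
  rewrite !ffunE; apply: (sorted_ltn_nth _ x0 (sorted_enum_set J)) => //.
  - by move=> y x z; exact: ltn_trans.
  - by rewrite inE -cardE Jd ltn_ord.
  - by rewrite inE -cardE Jd ltn_ord.
rewrite (reindex_onto h h') //; apply: eq_big => [i|i /andP[/[dup] hd _ /eqP hi]].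
  apply/andP/idP => [[hd /eqP <-]|ii]; first exact: h'incr.
  split; first by rewrite card_imset ?card_ord //; exact: incr_inj.
  apply/eqP/ffunP => l; rewrite ffunE /h enum_incr // (nth_map l) ?size_enum_ord ?ltn_ord //.
  by rewrite nth_ord_enum.
rewrite /h big_imset //= => a b _ _; apply: incr_inj; rewrite -hi.
exact: h'incr.
Qed.

(** Expand over subsets and group them by size; the empty subset gives the leading 1. *)
Lemma prod_1add_incr r (x0 : 'I_r) (B : 'I_r -> K) :
  \prod_k (1 + B k) = 1 + \sum_(1 <= d < r.+1)
    \sum_(i : {ffun 'I_d -> 'I_r} | incr i) \prod_(l < d) B (i l).
Proof.
under eq_bigr => k _ do rewrite addrC.
rewrite bigA_distr.
have -> : \sum_(J in {set 'I_r}) \prod_i (if i \in J then B i else 1) =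
    \sum_(J : {set 'I_r}) \prod_(k in J) B k.
  by apply: eq_big => // J _; rewrite -big_mkcond.
have cJ (J : {set 'I_r}) : (#|J| < r.+1)%N by rewrite ltnS -[r in (_ <= r)%N]card_ord max_card.
rewrite (partition_big (fun J : {set 'I_r} => Ordinal (cJ J)) xpredT) //=.
rewrite (eq_bigr (fun d : 'I_r.+1 => \sum_(J : {set 'I_r} | #|J| == d) \prod_(k in J) B k)) //.
rewrite -(big_mkord xpredT (fun d => \sum_(J : {set 'I_r} | #|J| == d) \prod_(k in J) B k)).
rewrite big_ltn //; congr (_ + _).
  rewrite (big_pred1 finset.set0) ?big_set0 // => J; by rewrite cards_eq0.
by apply: eq_bigr => d _; exact: sum_incr_prod.
Qed.

End InclusionExclusion.

(** * Limits and p-adic measures *)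

Section Limits.
Context {R : realType} {K : closedFieldType} (p : nat) (absp : K -> R).
Hypotheses (hp : prime p) (hCp : is_Cp p absp).
Implicit Types (u v : nat -> K) (l : K).

Lemma cvgpP u l : cvgp absp u l <->
  forall e, 0 < e -> exists N, forall n, (N <= n)%N -> absp (u n - l) < e.
Proof.
split=> [/cvgrPdist_lt ul e e0|ul].
  have [N _ Nu] := ul e e0; exists N => n /Nu /=.
  by rewrite sub0r normrN ger0_norm // (absp_ge0 hCp).
apply/cvgrPdist_lt => e /ul[N Nu]; exists N => // n /Nu /=.
by rewrite sub0r normrN ger0_norm // (absp_ge0 hCp).
Qed.

Lemma cvgp_unique u l l' : cvgp absp u l -> cvgp absp u l' -> l = l'.
Proof.
move=> /cvgpP ul /cvgpP ul'; apply/eqP; rewrite -subr_eq0 -(abs_eq0 hCp).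
rewrite eq_le (absp_ge0 hCp) andbT; apply/ler_addgt0Pl => e e0; rewrite addr0.
have [[N Nu] [N' Nu']] := (ul e e0, ul' e e0).
have := Nu _ (leq_maxl N N'); have := Nu' _ (leq_maxr N N').
move: (u _) => x xl' xl; rewrite -(subrK x l) -addrA ltW //.
by apply: (absD_lt hCp) => //; rewrite (absB hCp).
Qed.

Lemma limpE u l : cvgp absp u l -> limp absp u = l.
Proof.
move=> ul; rewrite /limp; case: xgetP => [l' _ ul'|/(_ l)]; last by case.
exact: cvgp_unique ul' ul.
Qed.

Lemma eq_cvgp N u v l : (forall n, (N <= n)%N -> u n = v n) ->
  cvgp absp u l -> cvgp absp v l.
Proof.
move=> uv /cvgpP ul; apply/cvgpP => e /ul[M Mu]; exists (maxn N M) => n.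
by rewrite geq_max => /andP[/uv <- /Mu].
Qed.

Lemma cvgp_cst l : cvgp absp (fun=> l) l.
Proof. by apply/cvgpP => e e0; exists 0%N => n _; rewrite subrr (abs0 hCp). Qed.

Lemma cvgpD u v l l' : cvgp absp u l -> cvgp absp v l' ->
  cvgp absp (fun n => u n + v n) (l + l').
Proof.
move=> /cvgpP ul /cvgpP vl; apply/cvgpP => e e0.
have [[N Nu] [M Mv]] := (ul e e0, vl e e0); exists (maxn N M) => n.
rewrite geq_max opprD addrACA => /andP[/Nu ? /Mv ?].
exact: (absD_lt hCp).
Qed.

Lemma cvgpZ a u l : cvgp absp u l -> cvgp absp (fun n => a * u n) (a * l).
Proof.
move=> /cvgpP ul; apply/cvgpP => e e0.
have a0 : 0 < absp a + 1 by rewrite ltr_wpDl // (absp_ge0 hCp).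
have [|N Nu] := ul (e / (absp a + 1)); first exact: divr_gt0.
exists N => n /Nu; rewrite ltr_pdivlMr // -mulrBr (abspM hCp); apply: le_lt_trans.
by rewrite mulrC ler_wpM2l ?(absp_ge0 hCp) // lerDl.
Qed.

Lemma cvgpM u v l l' : cvgp absp u l -> cvgp absp v l' ->
  cvgp absp (fun n => u n * v n) (l * l').
Proof.
move=> ul vl.
have uv0 : cvgp absp (fun n => (u n - l) * (v n - l')) 0.
  move/cvgpP : ul => ul; move/cvgpP : vl => vl.
  apply/cvgpP => e e0; have [[N Nu] [M Mv]] := (ul 1 ltr01, vl e e0).
  exists (maxn N M) => n; rewrite geq_max subr0 (abspM hCp) => /andP[/Nu ? /Mv ve].
  by apply: le_lt_trans ve; rewrite ler_piMl ?(absp_ge0 hCp) // ltW.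
have := cvgpD uv0 (cvgpD (cvgpD (cvgpZ l vl) (cvgpZ l' ul)) (cvgp_cst (- (l * l')))).
have -> : 0 + (l * l' + l' * l - l * l') = l * l' by ring.
by apply: (@eq_cvgp 0) => n _; ring.
Qed.

Lemma cvgp_sum (I : Type) (s : seq I) (P : pred I) (F : I -> nat -> K) (L : I -> K) :
  (forall i, P i -> cvgp absp (F i) (L i)) ->
  cvgp absp (fun n => \sum_(i <- s | P i) F i n) (\sum_(i <- s | P i) L i).
Proof.
move=> FL; elim: s => [|i s IH].
  by rewrite big_nil; apply: (@eq_cvgp 0) (cvgp_cst 0) => n _; rewrite big_nil.
rewrite big_cons; case: ifP => [Pi|Pi].
  by apply: (@eq_cvgp 0) (cvgpD (FL i Pi) IH) => n _; rewrite big_cons Pi.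
by apply: (@eq_cvgp 0) IH => n _; rewrite big_cons Pi.
Qed.

Lemma cvgp_padicZ u l : (forall n, padicZ absp (u n)) -> cvgp absp u l -> padicZ absp l.
Proof.
move=> uZ /cvgpP ul; apply/(padicZP hp hCp) => N.
have [M Mu] := ul _ (pXV_gt0 hp N); have /(padicZP hp hCp)/(_ N)[a ua] := uZ M.
exists a; rewrite -(subrK (u M) l) -addrA; apply: (absD_le hCp) => //.
by rewrite (absB hCp) ltW ?Mu.
Qed.

Lemma cvgp_le u l e : 0 < e -> (forall n, absp (u n) <= e) -> cvgp absp u l -> absp l <= e.
Proof.
move=> e0 ue /cvgpP/(_ e e0)[N Nu].
rewrite -(subKr (u N) l); apply: (absB_le hCp) => //.
by rewrite ltW ?Nu.
Qed.

Definition cvgps {r} (F : nat -> psr K r) (L : psr K r) :=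
  forall n, cvgp absp (fun N => F N n) (L n).

Lemma cvgps_cst r (L : psr K r) : cvgps (fun=> L) L.
Proof. by move=> n; exact: cvgp_cst. Qed.

Lemma cvgpsM r (F G : nat -> psr K r) (L M : psr K r) :
  cvgps F L -> cvgps G M -> cvgps (fun N => F N * G N) (L * M).
Proof.
move=> FL GM n; have [D nD] := mon_bound n.
rewrite (psr_mulE _ _ nD).
apply: (@eq_cvgp 0 (fun N => \sum_(a : {ffun 'I_r -> 'I_D.+1})
    \sum_(b : {ffun 'I_r -> 'I_D.+1}) (mon_add (mon_of a) (mon_of b) == n)%:R *
      (F N (mon_of a) * G N (mon_of b)))).
  by move=> N _; rewrite (psr_mulE _ _ nD).
by do 2![apply: cvgp_sum => ? _]; apply/cvgpZ/cvgpM.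
Qed.

Lemma cvgps_prod r (I : Type) (s : seq I) (F : I -> nat -> psr K r) (L : I -> psr K r) :
  (forall i, cvgps (F i) (L i)) ->
  cvgps (fun N => \prod_(i <- s) F i N) (\prod_(i <- s) L i).
Proof.
move=> FL; elim: s => [|i s IH] n.
  by rewrite big_nil; apply: (@eq_cvgp 0) (cvgps_cst 1 n) => N _; rewrite big_nil.
by rewrite big_cons; apply: (@eq_cvgp 0) (cvgpsM (FL i) IH n) => N _; rewrite big_cons.
Qed.

End Limits.

(** * The measures [mz] and [mtilde]: integrality and moments *)

Section Measures.
Context {R : realType} {K : closedFieldType} (p : nat) (absp : K -> R).
Hypotheses (hp : prime p) (hCp : is_Cp p absp).
Variable c : nat.
Hypotheses (hc : (1 < c)%N) (hcp : coprime c p).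
Local Notation padicZ := (padicZ absp).
Local Notation lin := (@lin K).

Lemma natf_c : c%:R != 0 :> K.
Proof. by apply: (natr_gt0_neq0 hp hCp); exact: ltnW. Qed.

Lemma abs_unity k (x : K) : (0 < k)%N -> x ^+ k = 1 -> absp x = 1.
Proof.
move=> k0 xk; apply/eqP; rewrite -(@pexpr_eq1 _ _ k) //; last exact: (absp_ge0 hCp).
by rewrite -(absX hCp) xk (abs1 hCp).
Qed.

Lemma abs_inv_1subr (x : K) : nontriv_roots c x -> absp (1 - x)^-1 <= 1.
Proof.
move=> [xc /eqP x1]; rewrite (inv_1subr_unity natf_c xc x1).
apply: (absM_le1 hCp); first by rewrite (absN hCp) (absV hCp) (abs_coprime hp hCp) ?invr1.
apply: (abs_sum_le hCp) => // i _; apply: (absM_le1 hCp); first exact: (abs_nat hCp).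
by rewrite (absX hCp) (abs_unity (ltnW hc) xc) expr1n.
Qed.

(** Since [p] is prime to [c], a Bezout relation recovers [x] from its power, which is therefore 1
    only if [x] is. *)
Lemma nontriv_rootsX N (x : K) : nontriv_roots c x -> nontriv_roots c (x ^+ (p ^ N)).
Proof.
move=> [xc x1]; split; first by rewrite exprAC xc expr1n.
move=> xN; apply: x1.
have pN0 : (0 < p ^ N)%N by rewrite expn_gt0 prime_gt0.
have [u v uv _] := egcdnP c pN0.
have co : coprime (p ^ N) c by rewrite coprime_sym coprimeXr.
rewrite (eqP co) in uv; have := congr1 (fun k => x ^+ k) uv.
by rewrite mulnC exprM xN expr1n exprD mulnC exprM xc expr1n mul1r.
Qed.

Section PrimitiveRoot.
Variable w : K.
Hypothesis wc : c.-primitive_root w.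

Lemma mtildeE N j : mtilde p c N j = \sum_(i < c.-1) mz p (w ^+ i.+1) N j.
Proof. exact/fsum_reindex/nontriv_roots_bij. Qed.

(** Adding the trivial root gives a full character sum, so the value is [c - 1] or [-1]. *)
Lemma padicZ_sum_prim_root k : padicZ (\sum_(i < c.-1) (w ^+ i.+1) ^+ k).
Proof.
have -> : \sum_(i < c.-1) (w ^+ i.+1) ^+ k = \sum_(i < c) (w ^+ k) ^+ i - 1.
  rewrite -[in RHS](ltn_predK hc) big_ord_recl expr0 addrC addKr.
  by apply: eq_bigr => i _; rewrite exprAC.
apply: (padicZB hp hCp); last exact: (padicZ_nat hp hCp 1).
rewrite sum_unity_powers; last by rewrite exprAC (prim_expr_order wc) expr1n.
by case: ifP => _; [exact: (padicZ_nat hp hCp)|exact: (padicZ_nat hp hCp 0)].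
Qed.

(** Writing [1 / (1 - xi^(p^N))] as a polynomial in [xi^(p^N)] with coefficients [-k / c] leaves
    power sums over the nontrivial roots, which are integers. *)
Lemma padicZ_mtilde N j : padicZ (mtilde p c N j).
Proof.
rewrite mtildeE /mz.
have -> : \sum_(i < c.-1) (w ^+ i.+1) ^+ j / (1 - (w ^+ i.+1) ^+ (p ^ N)) =
   - c%:R^-1 * \sum_(k < c) k%:R * \sum_(i < c.-1) (w ^+ i.+1) ^+ (j + p ^ N * k).
  under [in RHS]eq_bigr => k _ do rewrite mulr_sumr.
  rewrite exchange_big mulr_sumr; apply: eq_bigr => i _ /=.
  have [/(_ i Logic.I) /(nontriv_rootsX N)[xc /eqP x1] _ _] := nontriv_roots_bij wc.
  rewrite (inv_1subr_unity natf_c xc x1) mulrCA; congr (_ * _).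
  rewrite mulr_sumr; apply: eq_bigr => k _.
  by rewrite mulrCA exprD [in RHS]exprM.
apply: (padicZM hp hCp).
  by apply: (padicZN hp hCp); exact: (padicZV hp hCp).
apply: (padicZ_sum hp hCp) => k _; apply: (padicZM hp hCp).
  exact: (padicZ_nat hp hCp).
exact: padicZ_sum_prim_root.
Qed.

End PrimitiveRoot.

(** The constant term is 1, and a coefficient of positive degree carries a factor [p^N] against a
    denominator of bounded inverse. The hypothesis bears on [z ^+ p] so as to cover [z = rho * xi]
    with [rho ^+ p = 1]; from level 1 on the powers are nontrivial [c]-th roots of unity. *)
Lemma cvgps_kernel r (z : K) (b : 'I_r -> K) : nontriv_roots c (z ^+ p) ->
  cvgps absp (fun N => @psr_cst K r (1 - z ^+ (p ^ N))^-1 *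
      (1 - psr_texp (z ^+ (p ^ N)) (fun k => (p ^ N)%:R * b k))) 1.
Proof.
move=> zp n.
have zN N : nontriv_roots c (z ^+ (p ^ N.+1)) by rewrite expnS exprM; exact: nontriv_rootsX.
have z1 N : 1 - z ^+ (p ^ N.+1) != 0.
  by rewrite subr_eq0 eq_sym; apply/eqP; case: (zN N).
have [->|n0] := eqVneq n (mon0 r).
  apply: (eq_cvgp hCp (N := 1)) (cvgp_cst hCp _) => -[|N] // _.
  by rewrite psr_cstE psr_subE !psr_oneE eqxx psr_texp0 mulVf.
rewrite psr_oneE (negPf n0); apply/(cvgpP hCp) => e e0.
set M := absp (psr_texp 1 b n).
have M0 : 0 < M + 1 by rewrite ltr_wpDl // (absp_ge0 hCp).
have [N0 N0e] := pXV_small hp (divr_gt0 e0 M0).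
exists N0.+1 => -[//|N] leN; rewrite psr_cstE psr_subE psr_oneE (negPf n0) sub0r subr0.
have -> : psr_texp (z ^+ (p ^ N.+1)) (fun k => (p ^ N.+1)%:R * b k) n =
    z ^+ (p ^ N.+1) * (p ^ N.+1)%:R ^+ mon_deg n * psr_texp 1 b n.
  rewrite /psr_texp mul1r -mulrA; congr (_ * _); rewrite /mon_deg -prodrXr -big_split.
  by apply: eq_bigr => k _ /=; rewrite exprMn mulrA.
apply: (@le_lt_trans _ _ (p%:R ^- N.+1 * M)); last first.
  apply: le_lt_trans (_ : p%:R ^- N0 * (M + 1) < e); last by rewrite -ltr_pdivlMr.
  apply: ler_pM; [by rewrite ltW // (pXV_gt0 hp)|exact: (absp_ge0 hCp)| |by rewrite lerDl].
  rewrite lef_pV2 ?posrE ?exprn_gt0 ?ltr0n ?prime_gt0 //.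
  by rewrite ler_eXn2l ?ltr1n ?prime_gt1 // ltnW.
apply: (absM_le1 hCp); first exact: abs_inv_1subr.
rewrite (absN hCp) -mulrA; apply: (absM_le1 hCp).
  have [zc _] := zN N; by rewrite (abs_unity (ltnW hc) zc).
rewrite (abspM hCp) ler_wpM2r ?(absp_ge0 hCp) // natrX.
case: (mon_deg n) (mon_deg_eq0 n) => [|d _]; first by rewrite (negPf n0).
rewrite exprSr; apply: (absM_le1 hCp); last by rewrite (abs_pX hCp).
by rewrite -!natrX; exact: (abs_nat hCp).
Qed.

(** Each coordinate has its own measure [mz p (z j)], unlike in [integralZp], and the domain is the
    whole of Z_p^r. *)
Definition twisted_riemann r (n : 'I_r -> nat) (z gamma : 'I_r -> K) N : K :=
  \sum_(a : {ffun 'I_r -> 'I_(p ^ N)})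
    (\prod_k lin gamma (fun j => (a j : nat)%:R) k ^+ n k) *
    \prod_j mz p (z j) N (a j).

(** Compare coefficients at [n] in [twisted_gen_sum] with [P = p^N]: the correcting product tends to
    1 by [cvgps_kernel]. *)
Lemma cvgp_twistedB r (n : 'I_r -> nat) (z gamma : 'I_r -> K) :
  (forall j, nontriv_roots c (z j ^+ p)) ->
  cvgp absp (twisted_riemann n z gamma) (twistedB n z gamma).
Proof.
move=> zp; rewrite /twistedB; set m := [ffun i => n i].
pose b (j : 'I_r) k := if (j <= k)%N then gamma j else 0.
have H : cvgps absp (fun N => (twisted_gen z gamma : psr K r) *
    \prod_j (@psr_cst K r (1 - z j ^+ (p ^ N))^-1 *
      (1 - psr_texp (z j ^+ (p ^ N)) (fun k => (p ^ N)%:R * b j k))))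
    ((twisted_gen z gamma : psr K r) * \prod_(j < r) 1).
  apply: (cvgpsM hCp); first exact: (cvgps_cst hCp).
  by apply: (cvgps_prod hCp) => j; exact: cvgps_kernel.
rewrite big1_eq mulr1 in H.
apply: (eq_cvgp hCp (N := 1)) (cvgpZ hCp (\prod_i (n i)`!)%:R (H m)) => -[//|N] _.
rewrite (twisted_gen_sum (natrS_neq0 hp hCp)) => [|j]; last first.
  by apply/eqP; rewrite expnS exprM; have [] := nontriv_rootsX N (zp j).
rewrite psr_sumE mulr_sumr; apply: eq_bigr => a _.
rewrite (psr_texp_coef (natrS_neq0 hp hCp)).
rewrite mulrC; congr (_ * _); apply: eq_bigr => k _; congr (_ ^+ _).
rewrite /lin [RHS]big_mkcond; apply: eq_bigr => j _.
by rewrite /b; case: ifP; rewrite ?mulr0.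
Qed.

End Measures.

(** * Values of the L-function *)

Section IntegerPowers.
Variable K : fieldType.

Lemma expfz_sum (I : Type) (s : seq I) (P : pred I) (f : I -> int) (x : K) : x != 0 ->
  x ^ (\sum_(i <- s | P i) f i) = \prod_(i <- s | P i) x ^ f i.
Proof. by move=> x0; apply: (big_morph (fun n => x ^ n)) => // m n; exact: expfzDr. Qed.

Lemma expfz_prod (I : Type) (s : seq I) (P : pred I) (F : I -> K) (n : int) :
  (\prod_(i <- s | P i) F i) ^ n = \prod_(i <- s | P i) F i ^ n.
Proof.
by apply: (big_morph (fun x => x ^ n)); [move=> x y; exact: expfzMl|exact: exp1rz].
Qed.

End IntegerPowers.

(** * Integer powers from [angle] and [omega], and detection of units by characters modulo [p] *)

Section Values.
Context {R : realType} {K : closedFieldType} (p : nat) (absp : K -> R).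
Hypotheses (hp : prime p) (hCp : is_Cp p absp).
Local Notation padicZ := (padicZ absp).
Local Notation omega := (omega p absp).
Local Notation angle := (angle p absp).

(** Off the units [omega] may take its default value 1, still nonzero; hence the power identities
    below hold for every [x]. *)
Lemma omega_neq0 x : omega x != 0.
Proof.
rewrite /Defs.omega; case: xgetP => [w _ [Ww _]|_]; last exact: oner_neq0.
move: Ww; rewrite /Wp; case: ifP => _; last by case; case.
by case=> ->; rewrite ?oppr_eq0 oner_neq0.
Qed.

Lemma binomp_nat m n : binomp m%:R n = 'C(m, n)%:R :> K.
Proof.
rewrite /binomp; have -> : \prod_(i < n) (m%:R - i%:R) = (m ^_ n)%:R :> K.
  elim: n => [|n IH]; first by rewrite big_ord0.
  rewrite big_ord_recr /= IH ffactnSr natrM.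
  have [nm|mn] := leqP n m; first by rewrite natrB.
  by rewrite ffact_small // !mul0r.
by rewrite -bin_ffact natrM mulfK // (natr_gt0_neq0 hp hCp) // fact_gt0.
Qed.

(** At a natural exponent the binomial series stops after [n = m], so its partial sums are
    eventually constant. *)
Lemma angle_pow_nat x m : angle_pow p absp x m%:R = angle x ^+ m.
Proof.
apply: (limpE hCp); apply: (eq_cvgp hCp (N := m.+1)) (cvgp_cst hCp _) => N mN.
under eq_bigr => n _ do rewrite binomp_nat.
rewrite -{1}(subrK 1 (angle x)) exprD1n.
rewrite -!(big_mkord xpredT (fun n => (angle x - 1) ^+ n *+ 'C(m, n))).
rewrite -(big_mkord xpredT (fun n => 'C(m, n)%:R * (angle x - 1) ^+ n)).
rewrite [RHS](big_cat_nat (n := m.+1)) //= [X in _ = _ + X]big_nat_cond.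
rewrite [X in _ = _ + X]big1 ?addr0; last first.
  by move=> i /andP[/andP[mi _] _]; rewrite bin_small // mul0r.
by apply: eq_bigr => i _; rewrite mulr_natl.
Qed.

Lemma angle_pow_omega x m :
  angle_pow p absp x (- - m%:R) * omega x ^ (m%:Z) = x ^+ m.
Proof.
by rewrite opprK angle_pow_nat -exprnP -exprMn /Defs.angle divfK // omega_neq0.
Qed.

(** Orthogonality of characters modulo [p]: the left side detects whether [p] fails to divide
    [e]. *)
Lemma sum_unity_int (v : K) (e : int) : p.-primitive_root v ->
  1 - p%:R^-1 * \sum_(i < p) (v ^+ i) ^ e = (~~ (absp e%:~R <= p%:R ^- 1))%:R.
Proof.
move=> vp; have p0 := natr_gt0_neq0 hp hCp (prime_gt0 hp).
have -> : \sum_(i < p) (v ^+ i) ^ e = \sum_(i < p) (v ^ e) ^+ i.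
  by apply: eq_bigr => i _; rewrite !exprnP exprzAC.
rewrite sum_unity_powers; last by rewrite exprnP exprzAC -exprnP (prim_expr_order vp) exp1rz.
have -> : (v ^ e == 1) = (absp e%:~R <= p%:R ^- 1).
  rewrite (abs_intE hCp) (abs_nat_le hp hCp) expn1 (prim_order_dvd vp).
  by case: e => n; rewrite ?NegzE /= ?absz_nat // -exprnN invr_eq1.
by case: ifP => _; rewrite ?mulVf ?mulr0 ?subrr ?subr0.
Qed.

(** The level is at least 1, so [rho] disappears from the denominator. *)
Lemma mz_twist (rho xi : K) N j : rho ^+ p = 1 ->
  mz p (rho * xi) N.+1 j = rho ^+ j * mz p xi N.+1 j.
Proof.
by move=> rp; rewrite /mz !exprMn [in rho ^+ (p ^ _)]expnS exprM rp expr1n mul1r mulrA.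
Qed.

(** The very integer chosen inside [root_pow], so that [root_pow] at [g] unfolds to a power with
    exponent [residue g]. *)
Definition residue (g : K) : int := xget (0 : int) [set a : int | pdvd p absp 1 (g - a%:~R)].

Lemma residueP g : padicZ g -> absp (g - (residue g)%:~R) <= p%:R ^- 1.
Proof.
move=> gZ; have gZa (a : int) : padicZ (g - a%:~R).
  by apply: (padicZB hp hCp) => //; exact: (padicZ_int hp hCp).
rewrite /residue; case: xgetP => [a _ ga|/= no]; first exact/(pdvdP hp hCp 1 (gZa a)).
have /(padicZP hp hCp)/(_ 1%N)[a ga] := gZ; case: (no a%:Z).
exact/(pdvdP hp hCp 1 (gZa a)).
Qed.

Section Fixed.
Variables (r : nat) (gamma : 'I_r -> K).
Hypothesis hgamma : forall j, padicZ (gamma j).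
Local Notation lin := (lin gamma).

Lemma padicZ_lin x k : (forall j, padicZ (x j)) -> padicZ (lin x k).
Proof. by move=> xZ; apply: (padicZ_sum hp hCp) => j _; exact: (padicZM hp hCp). Qed.

(** An integer representative modulo [p] of the linear form, built from the exponents that
    [root_pow] produces. *)
Definition lin_residue (a : 'I_r -> nat) (k : 'I_r) : int :=
  \sum_(j < r | (j <= k)%N) (a j)%:Z * residue (gamma j).

Lemma lin_residueP (a : 'I_r -> nat) k :
  absp (lin (fun j => (a j)%:R) k - (lin_residue a k)%:~R) <= p%:R ^- 1.
Proof.
rewrite /Defs.lin /lin_residue rmorph_sum -sumrB; apply: (abs_sum_le hCp).
  by rewrite ltW // (pXV_gt0 hp).
move=> j _; rewrite rmorphM /= -mulrBr; apply: (absM_le1 hCp); first exact: (abs_nat hCp).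
exact: residueP.
Qed.

Lemma lin_nonunit (a : 'I_r -> nat) k :
  pdvd p absp 1 (lin (fun j => (a j)%:R) k) <-> absp (lin_residue a k)%:~R <= p%:R ^- 1.
Proof.
have aZ : padicZ (lin (fun j => (a j)%:R) k).
  by apply: padicZ_lin => j; exact: (padicZ_nat hp hCp).
have := lin_residueP a k; move: (lin _ k) aZ => x xZ; move: (_%:~R) => y xy.
rewrite (pdvdP hp hCp _ xZ); split=> h.
  by rewrite -(subKr x y); exact: (absB_le hCp).
by rewrite -(subrK y x); exact: (absD_le hCp).
Qed.

Lemma indic_Zpr' (v : K) (a : 'I_r -> nat) : p.-primitive_root v ->
  \1_(Zpr' p absp gamma) (fun j => (a j)%:R) =
  \prod_k (1 + - p%:R^-1 * \sum_(i < p) (v ^+ i) ^ (lin_residue a k)) :> K.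
Proof.
move=> vp; under eq_bigr => k _ do rewrite mulNr sum_unity_int //.
rewrite indicE; case: (boolP (_ \in _)); rewrite ?(in_setE, notin_setE) => aD.
  rewrite big1 // => k _; case: (boolP (_ <= _)) => // /lin_nonunit nk.
  by case: aD => _ /(_ k) [].
have [k kn] : exists k, absp (lin_residue a k)%:~R <= p%:R ^- 1.
  apply/not_existsP => no; apply: aD; split=> [j|k]; first exact: (padicZ_nat hp hCp).
  by move/lin_nonunit; exact: no.
by rewrite (bigD1 k) //= kn mul0r.
Qed.

Variables (x0 : 'I_r) (c : nat).
Hypotheses (hc : (1 < c)%N) (hcp : coprime c p).
Variables (v w : K).
Hypotheses (vp : p.-primitive_root v) (wc : c.-primitive_root w).

Definition char_c (f : {ffun 'I_r -> 'I_c.-1}) : {ffun 'I_r -> K} :=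
  [ffun j => w ^+ (f j).+1].

(** The root multiplying [xi_j] in the Bernoulli sum, with the unreduced [[ffun l => v ^+ h l] l]
    left by [fsum_ffun_reindex]. *)
Definition twist d (i : {ffun 'I_d -> 'I_r}) (h : {ffun 'I_d -> 'I_p}) (j : 'I_r) : K :=
  root_pow p absp (\prod_(l < d | (j <= i l)%N) [ffun l => v ^+ h l] l) (gamma j).

Lemma bernoulli_sumE (m : 'I_r -> nat) : bernoulli_sum p absp m gamma c =
  \sum_f twistedB m (char_c f) gamma +
  \sum_(1 <= d < r.+1) (- p%:R^-1) ^+ d * \sum_(i : {ffun 'I_d -> 'I_r} | incr i)
    \sum_(h : {ffun 'I_d -> 'I_p}) \sum_f
      twistedB m (fun j => twist i h j * char_c f j) gamma.
Proof.
have wb := nontriv_roots_bij wc.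
rewrite /bernoulli_sum (fsum_ffun_reindex _ wb); congr (_ + _).
apply: eq_bigr => d _; congr (_ * _); apply: eq_bigr => i _.
rewrite (fsum_ffun_reindex _ (roots_bij vp)); apply: eq_bigr => h _.
by rewrite (fsum_ffun_reindex _ wb).
Qed.

Lemma twist_expp d (i : {ffun 'I_d -> 'I_r}) h j : twist i h j ^+ p = 1.
Proof.
rewrite /twist /root_pow exprnP exprzAC -exprnP -prodrXl big1 ?exp1rz // => l _.
by rewrite ffunE exprAC (prim_expr_order vp) expr1n.
Qed.

(** Exchanging the products over [j] and [l] collects, for each [l], the exponents with [j <= i l],
    which add up to the linear form of index [i l]. *)
Lemma prod_twist d (i : {ffun 'I_d -> 'I_r}) (h : {ffun 'I_d -> 'I_p}) (a : 'I_r -> nat) :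
  \prod_j twist i h j ^+ a j = \prod_(l < d) (v ^+ h l) ^ lin_residue a (i l).
Proof.
have v0 : v != 0.
  have v1 := abs_unity hCp (prime_gt0 hp) (prim_expr_order vp).
  by rewrite -(abs_eq0 hCp) v1 oner_neq0.
transitivity (\prod_(j < r) \prod_(l < d | (j <= i l)%N)
    (v ^+ h l) ^ ((a j)%:Z * residue (gamma j))).
  apply: eq_bigr => j _; rewrite /twist /root_pow -/(residue _) expfz_prod -prodrXl.
  by apply: eq_bigr => l _; rewrite ffunE exprnP exprz_exp mulrC.
rewrite (exchange_big_dep xpredT) //=; apply: eq_bigr => l _.
by rewrite /lin_residue expfz_sum // expf_neq0.
Qed.

Definition riemann_sum (m : 'I_r -> nat) N : K :=
  \sum_(a : {ffun 'I_r -> 'I_(p ^ N)}) (\prod_k lin (fun j => (a j : nat)%:R) k ^+ m k) *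
    \1_(Zpr' p absp gamma) (fun j => (a j : nat)%:R) * \prod_j mtilde p c N (a j).

(** Expand the indicator by inclusion-exclusion. Each character value is a product of powers
    [twist ^+ a j], absorbed into the measures by [mz_twist]. *)
Lemma prod_mtilde N (a : 'I_r -> nat) :
  \1_(Zpr' p absp gamma) (fun j => (a j)%:R) * \prod_j mtilde p c N.+1 (a j) =
  \sum_f \prod_j mz p (char_c f j) N.+1 (a j) +
  \sum_(1 <= d < r.+1) (- p%:R^-1) ^+ d * \sum_(i : {ffun 'I_d -> 'I_r} | incr i)
    \sum_(h : {ffun 'I_d -> 'I_p}) \sum_f
      \prod_j mz p (twist i h j * char_c f j) N.+1 (a j).
Proof.
under [X in _ * X]eq_bigr => j _ do rewrite (mtildeE p wc).
rewrite bigA_distr_bigA /=.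
set S := \sum_(f : {ffun _ -> _}) _; set T := \sum_f _.
have ST : S = T.
  by apply: eq_bigr => f _; apply: eq_bigr => j _; rewrite ffunE.
rewrite {}ST (indic_Zpr' a vp) (prod_1add_incr x0) mulrDl mul1r; congr (_ + _).
rewrite mulr_suml; apply: eq_bigr => d _; rewrite mulr_suml mulr_sumr.
apply: eq_bigr => i _; rewrite big_split /= prodr_const card_ord -mulrA; congr (_ * _).
rewrite bigA_distr_bigA mulr_suml; apply: eq_bigr => h _ /=.
rewrite mulr_sumr; apply: eq_bigr => f _; rewrite -prod_twist -big_split.
by apply: eq_bigr => j _ /=; rewrite mz_twist // twist_expp.
Qed.

Lemma riemann_sumE (m : 'I_r -> nat) N : riemann_sum m N.+1 =
  \sum_f twisted_riemann p m (char_c f) gamma N.+1 +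
  \sum_(1 <= d < r.+1) (- p%:R^-1) ^+ d * \sum_(i : {ffun 'I_d -> 'I_r} | incr i)
    \sum_(h : {ffun 'I_d -> 'I_p}) \sum_f
      twisted_riemann p m (fun j => twist i h j * char_c f j) gamma N.+1.
Proof.
rewrite /riemann_sum /twisted_riemann.
under [LHS]eq_bigr => a _ do rewrite -mulrA prod_mtilde mulrDr mulr_sumr.
rewrite big_split /= exchange_big; congr (_ + _).
under [LHS]eq_bigr => a _ do rewrite mulr_sumr.
rewrite exchange_big; apply: eq_bigr => d _ /=.
under [LHS]eq_bigr => a _ do rewrite mulrCA.
rewrite -mulr_sumr; congr (_ * _).
under [LHS]eq_bigr => a _ do rewrite mulr_sumr.
rewrite exchange_big; apply: eq_bigr => i _ /=.
under [LHS]eq_bigr => a _ do rewrite mulr_sumr.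
rewrite exchange_big; apply: eq_bigr => h _ /=.
under [LHS]eq_bigr => a _ do rewrite mulr_sumr.
by rewrite exchange_big.
Qed.

Lemma cvgp_riemann_sum (m : 'I_r -> nat) :
  cvgp absp (riemann_sum m) (bernoulli_sum p absp m gamma c).
Proof.
have char_root f j : nontriv_roots c (char_c f j).
  by rewrite ffunE; have [wb _ _] := nontriv_roots_bij wc; exact: wb.
have char_rootp f j : nontriv_roots c (char_c f j ^+ p).
  by have := nontriv_rootsX hp hcp 1 (char_root f j); rewrite expn1.
rewrite bernoulli_sumE.
apply: (eq_cvgp hCp (N := 1) (u := fun N =>
  \sum_f twisted_riemann p m (char_c f) gamma N +
  \sum_(1 <= d < r.+1) (- p%:R^-1) ^+ d * \sum_(i : {ffun 'I_d -> 'I_r} | incr i)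
    \sum_(h : {ffun 'I_d -> 'I_p}) \sum_f
      twisted_riemann p m (fun j => twist i h j * char_c f j) gamma N)).
  by move=> [//|N] _; rewrite riemann_sumE.
apply: (cvgpD hCp).
  by apply: (cvgp_sum hCp) => f _; exact: (cvgp_twistedB hp hCp hc hcp).
apply: (cvgp_sum hCp) => d _; apply: (cvgpZ hCp).
do 3![apply: (cvgp_sum hCp) => ? _].
apply: (cvgp_twistedB hp hCp hc hcp) => j.
(* The twist dies in the [p]-th power, leaving [xi_j ^+ p]. *)
by rewrite exprMn twist_expp mul1r.
Qed.

(** The Riemann sums defining the L-value equal [riemann_sum] at every level, as [angle_pow_omega]
    holds at all points, units or not. *)
Lemma padicLE (m : 'I_r -> nat) :
  padicL p absp (fun j => - (m j)%:R) (fun j => (m j)%:Z) gamma c =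
  bernoulli_sum p absp m gamma c.
Proof.
apply: (limpE hCp); apply: (eq_cvgp hCp (N := 0)) (cvgp_riemann_sum m) => N _.
apply: eq_bigr => a _ /=; congr (_ * _ * _).
by apply: eq_bigr => k _; rewrite angle_pow_omega.
Qed.

Lemma padicZ_riemann_sum (m : 'I_r -> nat) N : padicZ (riemann_sum m N).
Proof.
apply: (padicZ_sum hp hCp) => a _; do 2?[apply: (padicZM hp hCp)].
- apply: (padicZ_prod hp hCp) => k _; apply: (padicZX hp hCp).
  by apply: padicZ_lin => j; exact: (padicZ_nat hp hCp).
- exact: (padicZ_nat hp hCp).
- by apply: (padicZ_prod hp hCp) => j _; exact: (padicZ_mtilde hp hCp hc hcp wc).
Qed.

(** Termwise by the ultrametric inequality: the weights are integral, the indicator removes points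
    where a linear form is a nonunit, and elsewhere Euler's theorem bounds the change of each
    factor. *)
Lemma abs_riemann_sum_sub (m n l : 'I_r -> nat) L N : (forall j, 0 < l j)%N ->
  (forall j, L <= l j)%N ->
  (forall j, m j = n j %[mod (p - 1) * p ^ (l j - 1)]) ->
  absp (riemann_sum m N - riemann_sum n N) <= p%:R ^- L.
Proof.
move=> l0 Ll mn; rewrite /riemann_sum -sumrB; apply: (abs_sum_le hCp).
  by rewrite ltW // (pXV_gt0 hp).
move=> a _; rewrite -!mulrBl mulrC; apply: (absM_le1 hCp).
  apply: padicZ_le1; apply: (padicZ_prod hp hCp) => j _.
  exact: (padicZ_mtilde hp hCp hc hcp wc).
rewrite indicE; case: (boolP (_ \in _)) => [|_]; last first.
  by rewrite mulr0 (abs0 hCp) ltW // (pXV_gt0 hp).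
rewrite in_setE mulr1 => -[aZ aU].
have linZ k := padicZ_lin k aZ.
have linX k q : absp (lin (fun j => (a j : nat)%:R) k ^+ q) <= 1.
  by apply: padicZ_le1; exact: (padicZX hp hCp).
apply: (abs_prod_sub hCp) => // k.
apply: (@le_trans _ _ (p%:R ^- l k)).
  apply: (abs_unit_exp_sub hp hCp) => //; apply/negP => h; apply: (aU k).
  exact/(pdvdP hp hCp 1 (linZ k)).
by rewrite lef_pV2 ?posrE ?exprn_gt0 ?ltr0n ?prime_gt0 // ler_eXn2l // ltr1n prime_gt1.
Qed.

(** Integrality and the bound [p^-L] both pass from the Riemann sums to their limits. *)
Lemma bernoulli_sum_congr (m n l : 'I_r -> nat) L : (forall j, 0 < l j)%N ->
  (forall j, L <= l j)%N ->
  (forall j, m j = n j %[mod (p - 1) * p ^ (l j - 1)]) ->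
  congrZp p absp L (bernoulli_sum p absp m gamma c) (bernoulli_sum p absp n gamma c).
Proof.
move=> l0 Ll mn.
have Z q := cvgp_padicZ hp hCp (padicZ_riemann_sum q) (cvgp_riemann_sum q).
apply: (congrZpP hp hCp) => //.
have := cvgpD hCp (cvgp_riemann_sum m) (cvgpZ hCp (-1) (cvgp_riemann_sum n)).
rewrite mulN1r; apply: (cvgp_le hCp); first exact: (pXV_gt0 hp).
by move=> N; rewrite mulN1r; exact: abs_riemann_sum_sub.
Qed.

End Fixed.
End Values.

Theorem theorem2p10 (R : realType) (p : nat) (hp : prime p)
    (Cp : closedFieldType) (absp : Cp -> R) (hCp : is_Cp p absp)
    (r : nat) (hr : (0 < r)%N) (m n l : 'I_r -> nat)
    (hl : forall j, (0 < l j)%N)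
    (hmn : forall j, (m j = n j %[mod (p - 1) * p ^ (l j - 1)])%N)
    (gamma : 'I_r -> Cp) (hgamma : forall j, padicZ absp (gamma j))
    (c : nat) (hc : (1 < c)%N) (hcp : coprime c p) :
  let lmin := l [arg min_(j < Ordinal hr) l j]%N in
  congrZp p absp lmin
    (padicL p absp (fun j => - (m j)%:R) (fun j => (m j)%:Z) gamma c)
    (padicL p absp (fun j => - (n j)%:R) (fun j => (n j)%:Z) gamma c)
  /\
  congrZp p absp lmin
    (bernoulli_sum p absp m gamma c)
    (bernoulli_sum p absp n gamma c).
Proof.
move=> lmin.
have [v vp] := prim_root_exists (prime_gt0 hp) (natr_gt0_neq0 hp hCp (prime_gt0 hp)).
have [w wc] := prim_root_exists (ltnW hc) (natr_gt0_neq0 hp hCp (ltnW hc)).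
have lmin_le j : (lmin <= l j)%N by rewrite /lmin; case: arg_minnP => // i _; apply.
have B : congrZp p absp lmin (bernoulli_sum p absp m gamma c) (bernoulli_sum p absp n gamma c).
  exact: (bernoulli_sum_congr hp hCp hgamma (Ordinal hr) hc hcp vp wc hl lmin_le hmn).
(* The L-values are the Bernoulli sums, so both congruences reduce to [B]. *)
by rewrite !(padicLE hp hCp hgamma (Ordinal hr) hc hcp vp wc).
Qed.
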